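(* Let $\{B_t\}_{t\in\mathbb{R}}$ be a standard Brownian motion on the real line and let $B_H(t)$, $t\in\mathbb{R}$, $H\in(0,1)$, be the moving average stochastic integrals $$B_H(t)=\frac{1}{c_H}\int_{-\infty}^{\infty}\left((t-x)_+^{H-\frac12}-(-x)_+^{H-\frac12}\right)dB_x,$$ all taken with respect to the same Brownian motion $\{B_t\}_{t\in\mathbb{R}}$. For $H,H'\in(0,1)$ and $s,t\in\mathbb{R}$ let $K=\mathbb{E}\,B_H(t)B_{H'}(s)$. (i) If $H+H'\neq 1$, then $$\begin{aligned}K=c_{H,H'}\,\Gamma(-(H+H'))\Big\{&\cos\left((H'-H)\tfrac{\pi}{2}\right)\cos\left((H+H')\tfrac{\pi}{2}\right)\left(|t-s|^{H+H'}-|t|^{H+H'}-|s|^{H+H'}\right)\\&-\sin\left((H'-H)\tfrac{\pi}{2}\right)\sin\left((H+H')\tfrac{\pi}{2}\right)\\&\quad\times\left(\mathrm{sgn}(t)|t|^{H+H'}-\mathrm{sgn}(s)|s|^{H+H'}-\mathrm{sgn}(t-s)|t-s|^{H+H'}\right)\Big\}.\end{aligned}$$ (ii) If $H+H'=1$ and $t\neq s$, $t\neq 0$, $s\neq 0$, then $$K=c_{H,H'}\Big\{\cos\left((H'-H)\tfrac{\pi}{2}\right)\tfrac{\pi}{2}\left(|t|+|s|-|t-s|\right)-\sin\left((H'-H)\tfrac{\pi}{2}\right)\left(t\log|t|-s\log|s|-(t-s)\log|t-s|\right)\Big\}.$$ (iii) If $H+H'=1$ and $t=s$, $t\neq 0$,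 then $$K=c_{H,H'}\cos\left((H'-H)\tfrac{\pi}{2}\right)\tfrac{\pi}{2}\{|t|+|s|\}.$$ (iv) If $H+H'=1$ and $t=0$ or $s=0$, then $K=0$.
   Context: A standard Brownian motion on the real line is obtained from two independent standard Brownian motions $B^1,B^2$ on $[0,\infty)$ by $B_t=B^1_{-t}$ for $t<0$ and $B_t=B^2_t$ for $t\ge 0$; the integrals are Wiener (Itô) integrals of deterministic $L^2(\mathbb{R})$ functions. Notation: $x_+^\alpha=x^\alpha$ if $x>0$ and $x_+^\alpha=0$ if $x\le 0$; $\mathrm{sgn}$ is the sign function with $\mathrm{sgn}(0)=0$; $\Gamma$ is the Gamma function; $$c_H=\frac{\Gamma(H+\frac12)}{\sqrt{\Gamma(2H+1)\sin(\pi H)}},\qquad c_{H,H'}=\frac{\sqrt{\Gamma(2H+1)\sin(\pi H)}\,\sqrt{\Gamma(2H'+1)\sin(\pi H')}}{\pi}.$$ *)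

(* Defs.v *)
From mathcomp Require Import all_boot all_order all_algebra.
From mathcomp Require Import all_classical all_reals all_analysis.

Set Implicit Arguments.
Unset Strict Implicit.
Unset Printing Implicit Defensive.
Import Order.TTheory GRing.Theory Num.Theory.
Import numFieldNormedType.Exports.

Local Open Scope classical_set_scope.
Local Open Scope ring_scope.

Definition Euler_Gamma {R : realType} (x : R) : R :=
  (\int[lebesgue_measure]_(u in `]0%R, +oo[) (u `^ (x - 1) * expR (- u)))%R.

(* For x <= 0 the recurrence Gamma (y + 1) = y * Gamma y is unfolded
   n = |floor x| times, which brings x + n into [0, 1[. The values at the poles
   0, -1, -2, ... are meaningless. *)
Definition Gamma {R : realType} (x : R) : R :=
  if 0 < x then Euler_Gamma x
  else let n := absz (Num.floor x) in
       Euler_Gamma (x + n%:R) / \prod_(k < n) (x + k%:R).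

(* x_+^a; the test is needed because powR 0 0 = 1 and powR x a = 1 for x < 0. *)
Definition pospow {R : realType} (x a : R) : R := if 0 < x then x `^ a else 0.

Definition c_one {R : realType} (H : R) : R :=
  Gamma (H + 2^-1) / Num.sqrt (Gamma (2 * H + 1) * sin (pi * H)).

Definition c_two {R : realType} (H H' : R) : R :=
  Num.sqrt (Gamma (2 * H + 1) * sin (pi * H))
  * Num.sqrt (Gamma (2 * H' + 1) * sin (pi * H')) / pi.

Section Processes.
Context {d : measure_display} {T : measurableType d} {R : realType}.
Variable P : probability T R.

(* Taking A i = setT for the indices outside a subfamily gives the product rule
   for that subfamily. *)
Definition mutually_independent (n : nat) (X : 'I_n -> T -> R) : Prop :=
  forall A : 'I_n -> set R, (forall i, measurable (A i)) ->
  P (\bigcap_(i in [set: 'I_n]) (X i @^-1` A i))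
  = (\prod_(i < n) fine (P (X i @^-1` A i)))%:E.

(* Processes on [0, +oo[ are represented by families indexed by R of which only
   the members with nonnegative index matter. *)
Definition generated_sigma_algebra (W : R -> {RV P >-> R}) : set (set T) :=
  <<s \bigcup_(t in `[0%R, +oo[) preimage_set_system setT (W t) measurable >>.

Definition independent_processes (W W' : R -> {RV P >-> R}) : Prop :=
  forall E F : set T,
  generated_sigma_algebra W E -> generated_sigma_algebra W' F ->
  P (E `&` F) = (P E * P F)%E.

(* The second parameter of normal_prob is the standard deviation. *)
Definition standard_brownian_motion (W : R -> {RV P >-> R}) : Prop :=
  [/\ {ae P, forall w, W 0 w = 0},
      forall (n : nat) (u : nat -> R), 0 <= u 0%N ->
        {homo u : i j / (i <= j)%N >-> i <= j} ->
        mutually_independent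
          (fun i : 'I_n => (W (u i.+1) : T -> R) \- W (u i)),
      forall s t : R, 0 <= s -> s < t -> forall A : set R, measurable A ->
        P (((W t : T -> R) \- W s) @^-1` A)
        = normal_prob 0 (Num.sqrt (t - s)) A
    & {ae P, forall w, {within `[0%R, +oo[, continuous (fun t => W t w)}}].

Definition brownian_motion_on_line (B : R -> {RV P >-> R}) : Prop :=
  exists B1 B2 : R -> {RV P >-> R},
  [/\ standard_brownian_motion B1, standard_brownian_motion B2,
      independent_processes B1 B2
    & forall t w, B t w = if t < 0 then B1 (- t) w else B2 t w].

(* A list of triples (a, (u, v)) with u <= v stands for the step function
   \sum a 1_]u, v]; the intervals may overlap. *)
Definition step_data : Type := seq (R * (R * R)).

Definition wf_step (f : step_data) : bool := all (fun p => p.2.1 <= p.2.2) f.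

Definition step_fun (f : step_data) (x : R) : R :=
  \sum_(p <- f) p.1 * \1_(`]p.2.1, p.2.2]) x.

Definition step_integral (B : R -> {RV P >-> R}) (f : step_data) (w : T) : R :=
  \sum_(p <- f) p.1 * (B p.2.2 w - B p.2.1 w).

(* I is (a version of) the Wiener integral of f: it is the L^2(P) limit of the
   integrals of step functions converging to f in L^2(R). The L^2 memberships
   of f and I are consequences of the convergences. *)
Definition is_wiener_integral (B : R -> {RV P >-> R}) (f : R -> R)
    (I : {RV P >-> R}) : Prop :=
  measurable_fun setT f /\
  exists phi : nat -> step_data,
  [/\ forall n, wf_step (phi n),
      (\int[lebesgue_measure]_x ((step_fun (phi n) x - f x) ^+ 2)%:E)%E
        @[n --> \oo] --> 0%E
    & ('E_P[(fun w => (step_integral B (phi n) w - I w) ^+ 2)%R])%E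
        @[n --> \oo] --> 0%E].

Definition is_moving_average (B : R -> {RV P >-> R}) (H : R)
    (X : R -> {RV P >-> R}) : Prop :=
  forall t : R, exists I : {RV P >-> R},
    is_wiener_integral B
      (fun x => pospow (t - x) (H - 2^-1) - pospow (- x) (H - 2^-1)) I
    /\ forall w, X t w = (c_one H)^-1 * I w.

End Processes.

(* Main.v *)
Require Import Defs.
From mathcomp Require Import all_boot all_order all_algebra.
From mathcomp Require Import all_classical all_reals all_analysis.
From mathcomp Require Import measurable_realfun ring lra.

Set Implicit Arguments.
Unset Strict Implicit.
Unset Printing Implicit Defensive.
Import Order.TTheory GRing.Theory Num.Theory.
Import numFieldNormedType.Exports.

Local Open Scope classical_set_scope.
Local Open Scope ring_scope.

(** Write [phi_a] for [pospow _ a], and put [a = H - 1/2], [b = H' - 1/2] and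
    [h = H + H'].  The Wiener integral is an isometry from L2 of the line to L2
    of the probability space, so the covariance is
    [(c_one H)^-1 * (c_one H')^-1] times the integral [Q(t, s)] of the product of
    the two kernels [phi_a (t - x) - phi_a (- x)] and [phi_b (s - x) - phi_b (- x)].

    The isometry ([wiener_isometry]).  For all [u] and [v] the number
    [|v - u|] is both the second moment of [B v - B u] and the squared L2 norm of
    [1_(-oo, v] - 1_(-oo, u]].  A product of two increments is a linear
    combination of squares of increments, hence these numbers determine the
    second moments of all step integrals and the norms of all step functions, by
    the same formula.  Equality of norms passes to L2 limits, and polarization
    gives equality of products.  For increments across the origin,
    independence of the two halves makes the mixed term vanish.

    The kernel integral when [h < 1].  The product of the kernels is a combination
    of three translates of [(phi_a (u + y) - phi_a y) * phi_b y], with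
    [u = t - s], [t] and [- s].  Writing the increment as the integral of a
    derivative turns the integral of this function into a Beta integral; it is
    homogeneous of degree [h] in [u], with one constant for [u > 0] and another
    one for [u < 0] ([integral_increment_product]).  The reflection formula gives
    both constants the same shape, in which the cosines of the statement appear.

    When [h > 1], one of the exponents, say [a], is positive.  The first
    kernel is then [a] times the integral of [phi_(a - 1) (r - x)] over [r] between [0]
    and [t], and Fubini's theorem reduces the problem to the previous case with
    exponents [b] and [a - 1], whose sum is [h - 2] ([kernel_product_pos]); the formula
    obtained is the same one.

    When [h = 1], replace [H'] by [H' - e] with [e] decreasing to [0].
    The bound [|f_b| <= |f_(-c)| + |f_c|] between kernels with [|b| <= c]
    ([mvn_kernel_bound]) makes the integrals converge; in the formula,
    [Gamma (- h)] behaves like [- 1 / e] while its cofactor vanishes at [e = 0], so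
    the limit is minus the derivative of the cofactor, which is where the logarithms
    come from ([kernel_covariance_limit]).

    The reflection formula ([Gamma_reflection]).  Let [I_n(x)] be the integral of
    [cos t ^+ n * cos (2 * x * t)] over [0 <= t <= pi / 2].  Two integrations by parts
    relate [I_(n + 2)] and [I_n], and by this relation the product of
    [I_(2k)(x) / I_(2k)(0)] and [Gamma (k + 1 + x) * Gamma (k + 1 - x) / k!^2] does
    not depend on [k].  Both factors tend to [1], and the value at [k = 0] is
    [Gamma (1 + x) * Gamma (1 - x) * sin (pi * x) / (pi * x)]. *)

(** * Functions with a given integral *)
Section has_integral.
Context {d : measure_display} {T : measurableType d} {R : realType}.
Variable mu : {measure set T -> \bar R}.
Implicit Types (f g : T -> R) (v w : R).

(** Integrability and value go together: a value alone would not survive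
    subtraction, and extended real numbers stay out of the computations below. *)
Definition has_integral f v : Prop :=
  mu.-integrable setT (EFin \o f) /\ (\int[mu]_x (f x)%:E = v%:E)%E.

Lemma has_integral_measurable f v : has_integral f v -> measurable_fun setT f.
Proof. by move=> [/measurable_int/measurable_EFinP]. Qed.

Lemma has_integral_unique f v w : has_integral f v -> has_integral f w -> v = w.
Proof. by move=> [_ fv] [_]; rewrite fv => -[]. Qed.

Lemma integrable_has_integral f : mu.-integrable setT (EFin \o f) ->
  exists v, has_integral f v.
Proof.
move=> fi; exists (fine (\int[mu]_x (f x)%:E)); split => //.
by rewrite fineK//; exact: integrable_fin_num.
Qed.

Lemma has_integralP f g v w : f =1 g -> v = w -> has_integral f v -> has_integral g w.
Proof. by move=> /funext -> ->. Qed.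

Lemma has_integral0 : has_integral (fun=> 0) 0.
Proof. by split; [exact: integrable0|rewrite integral0]. Qed.

Lemma has_integralD f g v w : has_integral f v -> has_integral g w ->
  has_integral (fun x => f x + g x) (v + w).
Proof.
move=> [fi fv] [gi gw]; split.
  exact: (eq_integrable measurableT _ _ (fun _ _ => erefl) (integrableD measurableT fi gi)).
by rewrite integralD_EFin// fv gw.
Qed.

Lemma has_integralZ k f v : has_integral f v ->
  has_integral (fun x => k * f x) (k * v).
Proof.
move=> [fi fv]; split.
  exact: (eq_integrable measurableT _ _ (fun _ _ => erefl) (integrableZl measurableT k fi)).
under eq_integral do rewrite EFinM.
by rewrite integralZl// fv.
Qed.

Lemma has_integralN f v : has_integral f v -> has_integral (fun x => - f x) (- v).
Proof.
move=> /(has_integralZ (-1)); apply: has_integralP => [x|];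
by rewrite mulN1r.
Qed.

Lemma has_integralB f g v w : has_integral f v -> has_integral g w ->
  has_integral (fun x => f x - g x) (v - w).
Proof. by move=> fv /has_integralN; exact: has_integralD. Qed.

Lemma has_integral_sum (I : Type) (s : seq I) (f : I -> T -> R) (v : I -> R) :
  (forall i, has_integral (f i) (v i)) ->
  has_integral (fun x => \sum_(i <- s) f i x) (\sum_(i <- s) v i).
Proof.
move=> fv; elim: s => [|i s IHs].
  by apply: has_integralP has_integral0 => [x|]; rewrite big_nil.
apply: has_integralP (has_integralD (fv i) IHs) => [x|]; by rewrite big_cons.
Qed.

Lemma ge0_has_integral f v : measurable_fun setT f -> (forall x, 0 <= f x) ->
  (\int[mu]_x (f x)%:E = v%:E)%E -> has_integral f v.
Proof.
move=> mf f0 fv; split => //; apply/integrableP; split.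
  exact/measurable_EFinP.
under eq_integral do rewrite /= ger0_norm//.
by rewrite fv ltry.
Qed.

Lemma has_integral_ge0 f v : (forall x, 0 <= f x) -> has_integral f v -> 0 <= v.
Proof.
move=> f0 [_ fv]; rewrite -lee_fin -fv integral_ge0// => x _.
by rewrite lee_fin.
Qed.

Lemma le_has_integral f g v w : has_integral f v -> has_integral g w ->
  (forall x, f x <= g x) -> v <= w.
Proof.
move=> fv gw fg; rewrite -subr_ge0.
apply: (has_integral_ge0 _ (has_integralB gw fv)) => x.
by rewrite subr_ge0.
Qed.

Lemma dominated_integrable f g : mu.-integrable setT (EFin \o g) ->
  measurable_fun setT f -> (forall x, `|f x| <= g x) ->
  mu.-integrable setT (EFin \o f).
Proof.
move=> gi mf fg; apply: le_integrable gi => //; first exact/measurable_EFinP.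
by move=> x _ /=; rewrite lee_fin (le_trans (fg x))// ler_norm.
Qed.

End has_integral.

Section tonelli.
Context {d1 d2 : measure_display} {T1 : measurableType d1}
  {T2 : measurableType d2} {R : realType}.
Variables (m1 : {sigma_finite_measure set T1 -> \bar R})
  (m2 : {sigma_finite_measure set T2 -> \bar R}).

Lemma tonelli_ereal (F : T1 * T2 -> R) (h : T1 -> R) (g : T2 -> R) :
  measurable_fun setT F -> (forall z, 0 <= F z) ->
  (forall x, \int[m2]_y (F (x, y))%:E = (h x)%:E)%E ->
  (forall y, \int[m1]_x (F (x, y))%:E = (g y)%:E)%E ->
  (\int[m1]_x (h x)%:E = \int[m2]_y (g y)%:E)%E.
Proof.
move=> mF F0 Fh Fg.
under eq_integral do rewrite -Fh.
under [RHS]eq_integral do rewrite -Fg.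
apply: (@fubini_tonelli _ _ _ _ _ m1 m2 (EFin \o F)).
  exact/measurable_EFinP.
by move=> x; rewrite lee_fin.
Qed.

(** Swaps the order of integration in the direction in which integrability is
    gained: the inner integrals are known on both sides, one outer integral is
    known, and the other one is the conclusion. *)
Lemma tonelli (F : T1 * T2 -> R) (h : T1 -> R) (g : T2 -> R) v :
  measurable_fun setT F -> (forall z, 0 <= F z) ->
  (forall x, has_integral m2 (fun y => F (x, y)) (h x)) ->
  (forall y, has_integral m1 (fun x => F (x, y)) (g y)) ->
  has_integral m2 g v -> has_integral m1 h v.
Proof.
move=> mF F0 Fh Fg [_ gv].
apply: ge0_has_integral.
- apply/measurable_EFinP.
  rewrite [X in measurable_fun _ X](_ : _ =
      fun x => (\int[m2]_y (EFin \o F) (x, y))%E); last first.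
    by apply/funext => x /=; rewrite (Fh x).2.
  apply: (measurable_fun_fubini_tonelli_F (EFin \o F)) => //.
    exact/measurable_EFinP.
- by move=> x; apply: (has_integral_ge0 _ (Fh x)) => y; exact: F0.
- rewrite -gv; apply: (tonelli_ereal mF F0) => [x|y]; first by rewrite (Fh x).2.
  by rewrite (Fg y).2.
Qed.

(** The function [k] carries the absolute integrability, in a form that is computed
    in the same way as [h]. *)
Lemma fubini_has_integral (F : T1 * T2 -> R) (h k : T1 -> R) (g : T2 -> R) v :
  measurable_fun setT F ->
  (forall x, has_integral m2 (fun y => F (x, y)) (h x)) ->
  (forall y, has_integral m1 (fun x => F (x, y)) (g y)) ->
  (forall x, has_integral m2 (fun y => `|F (x, y)|) (k x)) ->
  m1.-integrable setT (EFin \o k) ->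
  has_integral m2 g v -> has_integral m1 h v.
Proof.
move=> mF Fh Fg Fk ki gv.
have iF : (m1 \x m2)%E.-integrable setT (EFin \o F).
  apply/integrable12ltyP; first exact/measurable_EFinP.
  under eq_integral do rewrite (Fk _).2.
  exact: integrable_lty.
have hE : EFin \o h = fun x => (\int[m2]_y (F (x, y))%:E)%E.
  by apply/funext => x /=; rewrite (Fh x).2.
have mh : measurable_fun setT h.
  apply/measurable_EFinP; rewrite hE.
  exact: (@measurable_fubini_F _ _ _ _ _ m1 m2 (EFin \o F) iF).
split.
  apply: (dominated_integrable ki mh) => x.
  rewrite ler_norml lerNl; apply/andP; split.
    by apply: (le_has_integral (has_integralN (Fh x)) (Fk x)) => y; rewrite -normrN ler_norm.
  by apply: (le_has_integral (Fh x) (Fk x)) => y; rewrite ler_norm.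
have := @Fubini _ _ _ _ _ m1 m2 (EFin \o F) iF.
rewrite -gv.2 => E.
transitivity (\int[m1]_x \int[m2]_y (F (x,y))%:E)%E.
  by apply: eq_integral => x _; rewrite (Fh x).2.
by rewrite E; apply: eq_integral => y _; rewrite (Fg y).2.
Qed.

End tonelli.

(** * Affine changes of variable *)
(** The pushforward together with its measure structure; the proof that the map
    is measurable is an argument because no structure inference can find it for a
    bare function. *)
Definition image_measure d1 d2 (T1 : measurableType d1) (T2 : measurableType d2)
    (R : realType) (mu : {measure set T1 -> \bar R}) (f : T1 -> T2)
    (mf : measurable_fun setT f) : {measure set T2 -> \bar R} :=
  measure_function_pushforward__canonical__measure_function_Measure mu mf.

Section lebesgue_affine.
Context {R : realType}.
Notation leb := (@lebesgue_measure R).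
Implicit Types (c e : R).

Let aff c e (x : measurableTypeR R) : measurableTypeR R := c * x + e.

Let aff_measurable c e : measurable_fun setT (aff c e).
Proof. by apply: measurable_funD => //; exact: measurable_funM. Qed.

Let preimage_affine_itv c e (a b : R) : c != 0 -> a < b ->
  leb (aff c e @^-1` `]a, b]) = ((b - a) / `|c|)%:E.
Proof.
move=> c0 ab; have [cp|cn|/eqP] := ltgtP 0 c; last by rewrite eq_sym (negbTE c0).
- rewrite (_ : _ @^-1` _ = `](a - e) / c, (b - e) / c]%classic); last first.
    apply/seteqP; split => x /=; rewrite !in_itv/= /aff ltr_pdivrMr// ler_pdivlMr//;
    by rewrite ltrBlDr lerBrDr mulrC.
  rewrite lebesgue_measure_itv/= lte_fin ltr_pM2r ?invr_gt0// ltrD2r ab.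
  by rewrite -EFinB -mulrBl gtr0_norm// opprB addrA subrK.
- rewrite (_ : _ @^-1` _ = `[(b - e) / c, (a - e) / c[%classic); last first.
    apply/seteqP; split => x /=; rewrite !in_itv/= /aff ltr_ndivlMr// ler_ndivrMr//;
    by rewrite ltrBlDr lerBrDr mulrC andbC.
  rewrite lebesgue_measure_itv/= lte_fin ltr_nM2r ?invr_lt0// ltrD2r ab.
  rewrite -EFinB -mulrBl ltr0_norm// invrN mulrN -mulNr; congr (_ * _)%:E; ring.
Qed.

(** Lebesgue measure is determined by its values on bounded intervals, and there
    the preimage of an interval under an affine map is again an interval. *)
Let lebesgue_measure_affine c e (A : set R) : c != 0 -> measurable A ->
  leb A = mscale (NngNum (normr_ge0 c))
    (image_measure leb (aff_measurable c e)) A.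
Proof.
move=> c0 mA; apply: lebesgue_measure_unique mA => X [[a b] _ <-].
rewrite /mscale /= /pushforward.
have [ab|ba] := ltP a b.
  rewrite [X in _ = (_ * X)%E](preimage_affine_itv e c0 ab).
  rewrite lebesgue_measure_itv/= lte_fin ab.
  by rewrite -EFinB -EFinM mulrCA divff ?mulr1// normr_eq0.
have -> : [set` `](a, b).1, (a, b).2]] = set0 :> set R.
  by rewrite set_itv_ge -?leNgt ?bnd_simp.
rewrite measure0; apply/esym; rewrite -[RHS](mule0 `|c|%:E); congr (_ * _)%E.
exact: (measure0 leb).
Qed.

Lemma ge0_integral_affine c e (f : R -> R) : c != 0 -> measurable_fun setT f ->
  (forall x, 0 <= f x) ->
  (\int[leb]_x (f x)%:E = `|c|%:E * \int[leb]_x (f (c * x + e)%R)%:E)%E.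
Proof.
move=> c0 mf f0.
pose nu := mscale (NngNum (normr_ge0 c)) (image_measure leb (aff_measurable c e)).
transitivity (\int[nu]_x (f x)%:E)%E.
  by apply: eq_measure_integral => A mA _; exact: lebesgue_measure_affine.
rewrite ge0_integral_mscale//=; last 2 first.
- exact/measurable_EFinP.
- by move=> x _; rewrite lee_fin.
congr (_ * _)%E.
rewrite (ge0_integral_pushforward (aff_measurable c e))//.
- exact/measurable_EFinP.
- by move=> x _; rewrite lee_fin.
Qed.

(** The positive and negative parts of [f] are taken as half sums of [|f|] and [f],
    which stay within functions of known integral. *)
Lemma has_integral_affine c e (f : R -> R) v : c != 0 -> has_integral leb f v ->
  has_integral leb (fun x => f (c * x + e)) (v / `|c|).
Proof.
move=> c0 fv; have mf := has_integral_measurable fv.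
have ge0 g w : (forall x, 0 <= g x) -> has_integral leb g w ->
    has_integral leb (fun x => g (c * x + e)) (w / `|c|).
  move=> g0 gw; have mg := has_integral_measurable gw.
  apply: ge0_has_integral => //.
    exact: (measurableT_comp mg (aff_measurable c e)).
  have c0' : `|c| != 0 by rewrite normr_eq0.
  have := ge0_integral_affine e c0 mg g0; rewrite gw.2.
  case: (\int[leb]_x (g (c * x + e))%:E)%E => [r||].
  - by rewrite -EFinM => -[->]; rewrite mulrAC divff ?mul1r.
  - by rewrite gt0_muley// lte_fin normr_gt0.
  - by rewrite gt0_muleNy// lte_fin normr_gt0.
have [w fw] := integrable_has_integral (integrable_norm fv.1).
have fP : has_integral leb (fun x => 2^-1 * (`|f x| + f x)) (2^-1 * (w + v)).
  by apply: has_integralZ; apply: has_integralD.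
have fN : has_integral leb (fun x => 2^-1 * (`|f x| - f x)) (2^-1 * (w - v)).
  by apply: has_integralZ; apply: has_integralB.
have fP0 x : 0 <= 2^-1 * (`|f x| + f x).
  by rewrite mulr_ge0// -lerBlDr sub0r -normrN ler_norm.
have fN0 x : 0 <= 2^-1 * (`|f x| - f x) by rewrite mulr_ge0// subr_ge0 ler_norm.
apply: has_integralP (has_integralB (ge0 _ _ fP0 fP) (ge0 _ _ fN0 fN)) => [x|].
  by field.
by rewrite -mulrBl; congr (_ / _); field.
Qed.

Lemma has_integral_shift e (f : R -> R) v : has_integral leb f v ->
  has_integral leb (fun x => f (x + e)) v.
Proof.
move=> /(has_integral_affine e (oner_neq0 _)); apply: has_integralP => [x|].
  by rewrite mul1r.
by rewrite normr1 divr1.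
Qed.

Lemma has_integral_reflect e (f : R -> R) v : has_integral leb f v ->
  has_integral leb (fun x => f (e - x)) v.
Proof.
have N1 : -1 != 0 :> R by rewrite oppr_eq0 oner_eq0.
move=> /(has_integral_affine e N1); apply: has_integralP => [x|].
  by rewrite mulN1r addrC.
by rewrite normrN1 divr1.
Qed.

End lebesgue_affine.

(** * Limits of integrals *)
Lemma cvg_EFin_seq (R : realType) (u : nat -> R) (l : R) :
  u n @[n --> \oo] --> l -> (u n)%:E @[n --> \oo] --> l%:E.
Proof. by move=> ul; apply: cvg_EFin => //; exact: nearW. Qed.

Section limits.
Context {d : measure_display} {T : measurableType d} {R : realType}.
Variable mu : {measure set T -> \bar R}.

Lemma has_integral_indic (D : set T) (f : T -> R) v : measurable D ->
  mu.-integrable D (EFin \o f) -> (\int[mu]_(x in D) (f x)%:E = v%:E)%E ->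
  has_integral mu (fun x => \1_D x * f x) v.
Proof.
move=> mD fi fv.
have E x : ((EFin \o f) \_ D) x = (\1_D x * f x)%:E.
  by rewrite epatch_indic /= -EFinM mulrC.
split.
  by move/(integrable_mkcond _ mD): fi; apply: eq_integrable => // x _; rewrite E.
by rewrite -fv [RHS]integral_mkcond; apply: eq_integral => x _; rewrite E.
Qed.

Lemma monotone_has_integral (f_ : nat -> T -> R) (f : T -> R) (v : nat -> R) w :
  (forall n x, 0 <= f_ n x) ->
  (forall x, {homo f_ ^~ x : n m / (n <= m)%N >-> n <= m}) ->
  (forall n, has_integral mu (f_ n) (v n)) ->
  (forall x, f_ n x @[n --> \oo] --> f x) -> v n @[n --> \oo] --> w ->
  has_integral mu f w.
Proof.
move=> f0 nd fv cf cv.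
have mf n : measurable_fun setT (f_ n) := has_integral_measurable (fv n).
apply: ge0_has_integral.
- exact: (measurable_fun_cvg mf (fun x _ => cf x)).
- move=> x; rewrite -(cvg_lim (@Rhausdorff _) (cf x)).
  by apply: limr_ge; [apply/cvg_ex; exists (f x)|apply: nearW].
have := @cvg_monotone_convergence _ _ _ mu setT measurableT (fun n x => (f_ n x)%:E).
move=> /(_ _ _ _)H.
have {H} : (\int[mu]_x (f_ n x)%:E)%E @[n --> \oo] -->
    (\int[mu]_x limn (fun n => (f_ n x)%:E))%E.
  apply: H => //.
  - by move=> n; exact/measurable_EFinP.
  - by move=> n x _; rewrite lee_fin.
  - by move=> x _ n m nm; rewrite lee_fin; apply: nd.
have -> : (fun x => limn (fun n => (f_ n x)%:E)) = EFin \o f.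
  apply/funext => x; apply/cvg_lim => //.
  exact: (cvg_EFin_seq (cf x)).
move=> H.
have H' : (\int[mu]_x (f_ n x)%:E)%E @[n --> \oo] --> w%:E.
  under eq_cvg do rewrite (fv _).2.
  exact: cvg_EFin_seq.
exact: (cvg_unique _ H H').
Qed.

Lemma dominated_has_integral (f_ : nat -> T -> R) (f g : T -> R) (v : nat -> R) :
  mu.-integrable setT (EFin \o g) -> (forall n x, `|f_ n x| <= g x) ->
  (forall n, has_integral mu (f_ n) (v n)) ->
  (forall x, f_ n x @[n --> \oo] --> f x) ->
  exists2 w, has_integral mu f w & v n @[n --> \oo] --> w.
Proof.
move=> gi fg fv cf.
have mf n : measurable_fun setT (f_ n) := has_integral_measurable (fv n).
have mlim := measurable_fun_cvg mf (fun x _ => cf x).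
have [fi _ H] : [/\ mu.-integrable setT (EFin \o f), True &
   (\int[mu]_x (f_ n x)%:E)%E @[n --> \oo] --> (\int[mu]_x (f x)%:E)%E].
  have [|||||fi ? fl] := @dominated_convergence _ _ _ mu setT measurableT
    (fun n x => (f_ n x)%:E) (EFin \o f) (EFin \o g) => //.
  - by move=> n; exact/measurable_EFinP.
  - exact/measurable_EFinP.
  - by apply: aeW => x _; exact: (cvg_EFin_seq (cf x)).
  - by apply: aeW => x n _; rewrite lee_fin.
have [w fw] := integrable_has_integral fi.
exists w => //; rewrite fw.2 in H.
under eq_cvg do rewrite -[v _]/(fine (v _)%:E) -(fv _).2.
exact: fine_cvg.
Qed.
End limits.

(** * Integrals of powers *)
Section power_integrals.
Context {R : realType}.
Notation leb := (@lebesgue_measure R).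
Implicit Types (a b e p t x : R).

Lemma indic_itv_ocE a b x : \1_(`]a, b]) x = (a < x <= b)%R%:R :> R.
Proof. by rewrite indicE mem_setE in_itv. Qed.

Lemma is_derive_continuous (f : R -> R) x df :
  is_derive x 1 f df -> {for x, continuous f}.
Proof.
by move=> ?; apply: differentiable_continuous; apply/derivable1_diffP; exact: ex_derive.
Qed.

Lemma has_integral_FTC2 (F f : R -> R) a b : a <= b ->
  (forall x, a <= x <= b -> is_derive x 1 F (f x)) ->
  (forall x, a <= x <= b -> {for x, continuous f}) ->
  has_integral leb (fun x => \1_(`]a, b]) x * f x) (F b - F a).
Proof.
move=> ab dF cf.
have [ab'|ba] := ltP a b; last first.
  have <- : a = b by apply/eqP; rewrite eq_le ab.
  rewrite subrr; apply: has_integralP (has_integral0 _) => // x.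
  by rewrite indic_itv_ocE; case: ltP => //= ax; rewrite ?mul0r// leNgt ax mul0r.
have cF x : a <= x <= b -> {for x, continuous F}.
  move=> /dF Fx; apply: differentiable_continuous; apply/derivable1_diffP.
  exact: ex_derive.
have cfab : {within `[a, b], continuous f}.
  by apply: continuous_in_subspaceT => x; rewrite inE/= in_itv/=; exact: cf.
have fi : leb.-integrable `[a, b] (EFin \o f).
  by apply: continuous_compact_integrable => //; exact: segment_compact.
have sub : `]a, b] `<=` `[a, b].
  by apply: subset_itv; rewrite bnd_simp.
have fi' : leb.-integrable `]a, b] (EFin \o f).
  by apply: integrableS fi.
apply: has_integral_indic => //.
rewrite integral_itv_obnd_cbnd; last exact: measurable_int fi'.
rewrite EFinB; apply: continuous_FTC2 => //.
- split.
  + move=> x; rewrite in_itv/= => /andP[ax xb].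
    by apply: (@ex_derive _ _ _ _ _ _ (f x)); apply: dF; rewrite !ltW.
  + by apply: cvg_at_right_filter; apply: cF; rewrite lexx.
  + by apply: cvg_at_left_filter; apply: cF; rewrite lexx ltW.
- move=> x; rewrite in_itv/= => /andP[ax xb].
  have Fx : is_derive x 1 F (f x) by apply: dF; rewrite !ltW.
  by rewrite derive1E derive_val.
Qed.

Lemma continuous_powR p x : 0 < x -> {for x, continuous (@powR R ^~ p)}.
Proof.
move=> x0; apply: differentiable_continuous; apply/derivable1_diffP.
by apply: derivable_powR; rewrite in_itv/= x0.
Qed.

Lemma integral_powR_pos a b p : 0 < a -> a <= b -> p != 0 ->
  has_integral leb (fun x => \1_(`]a, b]) x * x `^ (p - 1)) ((b `^ p - a `^ p) / p).
Proof.
move=> a0 ab p0.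
have := @has_integral_FTC2 (@powR R ^~ p) (fun x => p * x `^ (p - 1)) a b ab.
move=> /(_ _ _)H.
have {}H := H (fun x xab => is_derive1_powR p (lt_le_trans a0 (andP xab).1)).
have {H} H := has_integralZ p^-1 (H _).
apply: has_integralP (H _) => [x||x /andP[ax _]].
- by rewrite mulrCA mulKf.
- by rewrite mulrC.
- apply: cvgM; first exact: cvg_cst.
  by apply: continuous_powR; apply: lt_le_trans a0 ax.
Qed.

(** The integrand is unbounded near [0] when [p < 1]; the integral is reached from
    the intervals that start at [t / (n + 1)], by monotone convergence. *)
Lemma integral_powR0 t p : 0 <= t -> 0 < p ->
  has_integral leb (fun x => \1_(`]0, t]) x * x `^ (p - 1)) (t `^ p / p).
Proof.
rewrite le_eqVlt => /predU1P[<- p0|t0 p0].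
  rewrite powR0 ?gt_eqF// mul0r; apply: has_integralP (has_integral0 _) => // x.
  by rewrite set_itvoc0 indic0 mul0r.
pose u n := t * n.+1%:R^-1.
have u0 n : 0 < u n by rewrite mulr_gt0// invr_gt0 ltr0n.
have ut n : u n <= t.
  by rewrite /u ler_piMr //; [exact: ltW|rewrite invf_le1 ?ler1n].
have cu : u n @[n --> \oo] --> 0.
  by rewrite -[X in _ --> X](mulr0 t); apply: cvgMr; exact: cvg_harmonic.
apply: (monotone_has_integral (v := fun n => (t `^ p - u n `^ p) / p) _ _
  (fun n => integral_powR_pos (u0 n) (ut n) (lt0r_neq0 p0))).
- by move=> n x; rewrite mulr_ge0// powR_ge0.
- move=> x n m nm; rewrite ler_wpM2r ?powR_ge0// !indic_itv_ocE ler_nat.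
  case: (ltP (u n) x) => //= unx; rewrite (le_lt_trans _ unx)//.
  by apply: ler_wpM2l; [exact: ltW|rewrite lef_pV2 ?posrE// ler_nat].
- move=> x; apply: cvgMl; apply: cvg_near_cst.
  have [x0|x0] := ltP 0 x.
    near=> n; rewrite !indic_itv_ocE x0 (_ : u n < x)//.
    by near: n; apply: (cvgr_lt _ cu).
  apply: nearW => n; rewrite !indic_itv_ocE !ltNge x0 (le_trans x0)//.
  exact: ltW.
- apply: cvgMl; rewrite -[X in _ --> X]subr0; apply: cvgB; first exact: cvg_cst.
  by move/cvg_at_rightP: (powR_cvg0 p0); apply; split.
Unshelve. all: by end_near. Qed.
End power_integrals.

Section pospow.
Context {R : realType}.
Notation leb := (@lebesgue_measure R).
Implicit Types (a b e p t x y : R).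

Lemma pospow_ge0 x a : 0 <= pospow x a.
Proof. by rewrite /pospow; case: ifP => // _; rewrite powR_ge0. Qed.

Lemma pospow_gt0E x a : 0 < x -> pospow x a = x `^ a.
Proof. by rewrite /pospow => ->. Qed.

Lemma pospow_le0E x a : x <= 0 -> pospow x a = 0.
Proof. by rewrite /pospow ltNge => ->. Qed.

Lemma pospowD x a b : pospow x (a + b) = pospow x a * pospow x b.
Proof.
rewrite /pospow; case: ifPn => x0; last by rewrite mulr0.
by rewrite powRD// (gt_eqF x0) implybT.
Qed.

Lemma pospow_scale c x a : 0 < c -> pospow (c * x) a = c `^ a * pospow x a.
Proof.
move=> c0; rewrite /pospow pmulr_rgt0//; case: ifPn => x0; last by rewrite mulr0.
by rewrite powRM// ltW.
Qed.

Lemma measurable_pospow a : measurable_fun setT (fun x : R => pospow x a).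
Proof.
by apply: measurable_fun_ifT => //; exact: measurable_fun_ltr.
Qed.

Lemma measurable_pospow_comp d (T : measurableType d) (f : T -> R) a :
  measurable_fun setT f -> measurable_fun setT (fun z => pospow (f z) a).
Proof. by move=> mf; apply: (measurableT_comp (measurable_pospow a) mf). Qed.

(** One formula for all positions of [x] with respect to [0] and [t]: this is what makes
    it possible to integrate kernels over the whole line without case analysis. *)
Lemma integral_pospow t e x : 0 <= t -> 0 < e ->
  has_integral leb (fun r => \1_(`]0, t]) r * pospow (r - x) (e - 1))
    ((pospow (t - x) e - pospow (- x) e) / e).
Proof.
move=> t0 e0; have [x0|x0] := leP 0 x.
  rewrite [pospow (- x) e]pospow_le0E ?oppr_le0// subr0.
  have [tx|xt] := leP t x.
    rewrite pospow_le0E ?subr_le0// mul0r.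
    apply: has_integralP (has_integral0 _) => // r; rewrite indic_itv_ocE.
    have [rt|rt] := leP r t; last by rewrite andbF mul0r.
    by rewrite pospow_le0E ?mulr0// subr_le0 (le_trans rt).
  have tx0 : 0 <= t - x by rewrite subr_ge0 ltW.
  rewrite pospow_gt0E ?subr_gt0//.
  apply: has_integralP (has_integral_shift (- x) (integral_powR0 tx0 e0)) => // r.
  rewrite !indic_itv_ocE lerD2r /pospow subr_gt0.
  by have [xr|] := ltP x r; rewrite ?mul0r ?mulr0// (le_lt_trans x0 xr).
have Nx : 0 < - x by rewrite oppr_gt0.
have tx : - x <= t - x by rewrite lerDr.
rewrite !pospow_gt0E// ?(lt_le_trans Nx)//.
have := has_integral_shift (- x) (integral_powR_pos Nx tx (lt0r_neq0 e0)).
apply: has_integralP => // r.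
rewrite !indic_itv_ocE lerD2r ltrDr; have [r0|] := ltP 0 r; rewrite ?mul0r//.
by rewrite pospow_gt0E// subr_gt0 (lt_trans x0).
Qed.

(** Away from the singularity the exponent may be negative. *)
Lemma integral_pospow_pos u y p : 0 <= u -> 0 < y -> p != 0 ->
  has_integral leb (fun r => \1_(`]0, u]) r * pospow (r + y) (p - 1))
    ((pospow (u + y) p - pospow y p) / p).
Proof.
move=> u0 y0 p0; have uy : y <= u + y by rewrite lerDr.
rewrite !pospow_gt0E// ?(lt_le_trans y0)//.
have := has_integral_shift y (integral_powR_pos y0 uy p0).
apply: has_integralP => // r.
rewrite !indic_itv_ocE lerD2r ltrDr; have [r0|] := ltP 0 r; rewrite ?mul0r//.
by rewrite pospow_gt0E// addr_gt0.
Qed.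

Lemma has_integral_FTC2y (F f : R -> R) (b : bool) a l : (forall x, a <= x -> 0 <= f x) ->
  (forall x, is_derive x 1 F (f x)) -> continuous f -> F x @[x --> +oo] --> l ->
  has_integral leb (fun x => \1_([set` Interval (BSide b a) +oo%O]) x * f x) (l - F a).
Proof.
move=> f0 dF cf Fl.
have mf : measurable_fun setT f by exact: continuous_measurable_fun.
have E : (\int[leb]_(x in `[a, +oo[) (f x)%:E = (l - F a)%:E)%E.
  rewrite EFinB; apply: ge0_continuous_FTC2y => //.
  - by apply: continuous_in_subspaceT => x _; exact: cf.
  - apply: cvg_at_right_filter; apply: differentiable_continuous; apply/derivable1_diffP.
    by case: (dF a).
  - by move=> x _; rewrite derive1E derive_val.
apply: ge0_has_integral.
- apply: measurable_funM => //; exact: measurable_indic.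
- move=> x; rewrite indicE mem_setE in_itv/= andbT.
  case: b => /=.
    by case: (leP a x) => ax; [rewrite mulr_ge0// f0|rewrite mul0r].
  by case: (ltP a x) => ax; [rewrite mulr_ge0// f0// ltW|rewrite mul0r].
- transitivity (\int[leb]_(x in [set` Interval (BSide b a) +oo%O]) (f x)%:E)%E.
    rewrite [RHS]integral_mkcond; apply: eq_integral => x _.
    by rewrite epatch_indic /= -EFinM mulrC.
  case: b => //; rewrite integral_itv_obnd_cbnd//.
  by apply/measurable_EFinP; exact: measurable_funS mf.
Qed.

End pospow.

(** * The Gamma function *)
Lemma le_of_eq (R : realType) (x y : R) : x = y -> x <= y.
Proof. by move=> ->. Qed.

Section Euler_Gamma.
Context {R : realType}.
Notation leb := (@lebesgue_measure R).
Implicit Types (c p q s u x y v : R).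

Definition Gamma_integrand x u : R := pospow u (x - 1) * expR (- u).

Lemma Gamma_integrand_ge0 x u : 0 <= Gamma_integrand x u.
Proof. by rewrite mulr_ge0// ?pospow_ge0// expR_ge0. Qed.

Lemma measurable_expRN : measurable_fun setT (fun u : R => expR (- u)).
Proof. by apply: measurableT_comp => //; exact: measurable_expR. Qed.

Lemma measurable_Gamma_integrand x : measurable_fun setT (Gamma_integrand x).
Proof.
by apply: measurable_funM; [exact: measurable_pospow|exact: measurable_expRN].
Qed.

Lemma Euler_GammaE x : Euler_Gamma x = fine (\int[leb]_u (Gamma_integrand x u)%:E)%E.
Proof.
rewrite /Euler_Gamma Rintegral_mkcond /Rintegral; congr fine.
apply: eq_integral => u _; rewrite patchE /Gamma_integrand /pospow.
by rewrite mem_setE in_itv/= andbT; case: ifP => //; rewrite mul0r.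
Qed.

Lemma integral_expRN (b : bool) u :
  has_integral leb (fun v => \1_([set` Interval (BSide b u) +oo%O]) v * expR (- v))
    (expR (- u)).
Proof.
have := @has_integral_FTC2y R (fun v => - expR (- v)) (fun v => expR (- v)) b u 0.
rewrite sub0r opprK; apply.
- by move=> v _; rewrite expR_ge0.
- by move=> v; apply: is_derive_eq; rewrite mulrN1 opprK.
- by move=> v; apply: continuous_comp; [exact: continuousN|exact: continuous_expR].
- by rewrite -oppr0; apply: cvgN; exact: cvgr_expR.
Qed.

(** This is the functional equation, in a form that transports integrability both
    ways.  Integrate [x * u `^ (x - 1) * expR (- v)] over [0 < u <= v]: over [v] first
    it gives the left function, over [u] first the right one.  Integration by parts would
    need integrability beforehand. *)
Lemma Gamma_tonelli x (h g : R -> R) v : 0 < x ->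
  h =1 (fun u => x * Gamma_integrand x u) -> g =1 Gamma_integrand (x + 1) ->
  (has_integral leb h v <-> has_integral leb g v).
Proof.
move=> x0 /funext -> /funext ->.
pose F (z : R * R) := (if z.1 <= z.2 then pospow z.1 (x - 1) * expR (- z.2) else 0) * x.
have mF : measurable_fun setT F.
  apply: measurable_funM => //; apply: measurable_fun_ifT => //.
    exact: measurable_fun_ler.
  apply: measurable_funM; first exact: measurable_pospow_comp.
  by apply: (measurableT_comp measurable_expRN).
have F0 z : 0 <= F z.
  rewrite mulr_ge0//; last exact: ltW.
  by case: ifP => // _; rewrite mulr_ge0 ?pospow_ge0 ?expR_ge0.
have F1 u : has_integral leb (fun v => F (u, v)) (x * Gamma_integrand x u).
  apply: has_integralP (has_integralZ (x * pospow u (x - 1)) (integral_expRN true u)).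
    move=> w; rewrite /F/= indicE mem_setE in_itv/= andbT.
    by case: ifP => _ /=; ring.
  by rewrite /Gamma_integrand mulrA.
have F2 w : has_integral leb (fun u => F (u, w)) (Gamma_integrand (x + 1) w).
  have [w0|w0] := leP 0 w; last first.
    rewrite /Gamma_integrand pospow_le0E ?mul0r; last exact: ltW.
    apply: has_integralP (has_integral0 _) => // u; rewrite /F/=.
    case: ifPn => uw; last by rewrite mul0r.
    by rewrite pospow_le0E ?mul0r// (le_trans uw)// ltW.
  apply: has_integralP (has_integralZ (x * expR (- w)) (integral_pospow 0 w0 x0)).
    move=> u; rewrite /F/= indic_itv_ocE subr0 /pospow.
    by case: (ltP 0 u) => u0 /=; case: (leP u w) => uw /=; ring.
  rewrite /Gamma_integrand addrK subr0 oppr0 (pospow_le0E _ (lexx _)) subr0.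
  by field; rewrite gt_eqF.
split=> H.
  pose F' (z : R * R) := F (z.2, z.1).
  apply: (@tonelli _ _ _ _ _ leb leb F' _ _ _ _ _ F2 F1 H) => [|z]; last exact: F0.
  by apply: (measurableT_comp mF); exact: measurable_fun_pair.
exact: (@tonelli _ _ _ _ _ leb leb F _ _ _ mF F0 F1 F2 H).
Qed.

Lemma Gamma_integrand_1 : has_integral leb (Gamma_integrand 1) 1.
Proof.
apply: has_integralP (integral_expRN false 0).
  move=> u; rewrite /Gamma_integrand subrr indicE mem_setE in_itv/= andbT /pospow.
  by rewrite powRr0; case: ifP.
by rewrite oppr0 expR0.
Qed.

Lemma Gamma_integrand_nat n : has_integral leb (Gamma_integrand n.+1%:R) n`!%:R.
Proof.
elim: n => [|n IHn]; first exact: Gamma_integrand_1.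
rewrite -[n.+2]addn1 natrD.
have n0 : 0 < n.+1%:R :> R by rewrite ltr0n.
apply/(Gamma_tonelli _ n0 (fun=> erefl) (fun=> erefl)).
by apply: has_integralP (has_integralZ n.+1%:R IHn) => //; rewrite factS natrM.
Qed.

(** For [x >= 1] the integrand is at most the sum of those at [1] and at a large
    integer; for smaller [x] integrability descends from [x + 1] by
    [Gamma_tonelli]. *)
Lemma Gamma_has_integral x : 0 < x ->
  has_integral leb (Gamma_integrand x) (Euler_Gamma x).
Proof.
move=> x0; suff [v xv] : exists v, has_integral leb (Gamma_integrand x) v.
  by rewrite Euler_GammaE xv.2.
have ge1 y : 1 <= y -> exists v, has_integral leb (Gamma_integrand y) v.
  move=> y1; apply: integrable_has_integral.
  pose n := Num.truncn y; have yn : y <= n.+1%:R by rewrite ltW// truncnS_gt.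
  have [gi _] := has_integralD Gamma_integrand_1 (Gamma_integrand_nat n).
  apply: (dominated_integrable gi (measurable_Gamma_integrand y)) => u. 
  rewrite ger0_norm ?Gamma_integrand_ge0// /Gamma_integrand -mulrDl.
  rewrite ler_wpM2r ?expR_ge0// /pospow; case: ifPn => [u0|_]; last by rewrite addr0.
  rewrite subrr powRr0; have [u1|u1] := leP u 1.
    rewrite (@le_trans _ _ 1) ?lerDl ?powR_ge0//.
    by rewrite -[leRHS](powRr0 u); apply: ger_powR; rewrite ?u0 ?u1 ?subr_ge0.
  rewrite (@le_trans _ _ (u `^ (n.+1%:R - 1))) ?lerDr//.
  by apply: ler_powR; [exact: ltW|rewrite lerD2r].
have [v xv1] : exists v, has_integral leb (Gamma_integrand (x + 1)) v.
  by apply: ge1; rewrite lerDr ltW.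
have xv := (Gamma_tonelli v x0 (fun=> erefl) (fun=> erefl)).2 xv1.
exists (x^-1 * v); apply: has_integralP (has_integralZ x^-1 xv) => // u.
by rewrite mulKf// gt_eqF.
Qed.

Lemma Euler_GammaS x : 0 < x -> Euler_Gamma (x + 1) = x * Euler_Gamma x.
Proof.
move=> x0; have x10 : 0 < x + 1 by rewrite addr_gt0.
apply: (has_integral_unique (Gamma_has_integral x10)).
apply/(Gamma_tonelli _ x0 (fun=> erefl) (fun=> erefl)).
exact/has_integralZ/Gamma_has_integral.
Qed.

Lemma Euler_Gamma1 : Euler_Gamma 1 = 1 :> R.
Proof. exact: (has_integral_unique (Gamma_has_integral ltr01) Gamma_integrand_1). Qed.

Lemma Gamma_scaled q y : -1 < q -> 0 < y ->
  has_integral leb (fun u => pospow u q * expR (- (y * u)))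
    (Euler_Gamma (q + 1) * y `^ (- (q + 1))).
Proof.
move=> q1 y0; have q10 : 0 < q + 1 by rewrite -ltrBlDr sub0r.
have y0' : y != 0 by rewrite gt_eqF.
have := has_integral_affine 0 y0' (Gamma_has_integral q10).
move=> /(has_integralZ (y `^ (- q))); apply: has_integralP => [u|].
  rewrite /Gamma_integrand addr0 addrK pospow_scale// !mulrA -powRD ?y0' ?implybT//.
  by rewrite addNr powRr0 mul1r.
rewrite gtr0_norm// mulrCA; congr (_ * _).
by rewrite -powR_inv1 ?ltW// -powRD ?y0' ?implybT// opprD.
Qed.

(** The tangent inequality of the concave function [u `^ s] at [c]. *)
Lemma young_powR c s u : 0 < c -> 0 < u -> 0 <= s <= 1 ->
  u `^ s <= c `^ s * (1 - s) + c `^ (s - 1) * s * u.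
Proof.
move=> c0 u0 /andP[]; rewrite le_eqVlt => /predU1P[<- _|s0].
  by rewrite !powRr0 subr0 mulr0 mul0r addr0 mulr1.
rewrite le_eqVlt => /predU1P[->|s1].
  by rewrite subrr powRr0 mulr0 add0r !mul1r powRr1// ltW.
have r0 : 0 < u / c by rewrite divr_gt0.
have s10 : 0 < 1 - s by rewrite subr_gt0.
have := @conjugate_powR _ ((u / c) `^ s) 1 s^-1 (1 - s)^-1 (powR_ge0 _ _) ler01.
rewrite !invrK -!powRrM divff ?gt_eqF// powRr1 ?(ltW r0)// powR1 mul1r mulr1.
rewrite !invr_gt0 => /(_ s0 s10); rewrite addrCA subrr addr0 => /(_ erefl) H.
have -> : u `^ s = c `^ s * (u / c) `^ s.
  by rewrite -powRM ?(ltW c0)// ?ltW// mulrC divfK// gt_eqF.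
rewrite (le_trans (ler_wpM2l (powR_ge0 _ _) H))//.
have c0' : c != 0 by rewrite gt_eqF.
rewrite powRB ?c0' ?implybT// powRr1 ?(ltW c0)//.
by apply: le_of_eq; field.
Qed.

(** Integrating the tangent inequality at [c = x] against [u `^ (x - 1) * expR (- u)]
    turns its right-hand side into multiples of the values at [x] and
    at [x + 1], which add up to [x `^ s] times the value at [x].  This replaces
    log-convexity everywhere below. *)
Lemma Euler_Gamma_wendel x s : 0 < x -> 0 <= s <= 1 ->
  Euler_Gamma (x + s) <= x `^ s * Euler_Gamma x.
Proof.
move=> x0 s01; have xs0 : 0 < x + s by case/andP: s01 => s0 _; rewrite ltr_wpDr.
have x10 : 0 < x + 1 by rewrite addr_gt0.
have H := has_integralD (has_integralZ (x `^ s * (1 - s)) (Gamma_has_integral x0))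
  (has_integralZ (x `^ (s - 1) * s) (Gamma_has_integral x10)).
rewrite (le_trans (le_has_integral (Gamma_has_integral xs0) H _))//.
  move=> u; rewrite /Gamma_integrand !mulrA -mulrDl ler_wpM2r ?expR_ge0//.
  have [u0|u0] := ltP 0 u; last by rewrite !pospow_le0E// !mulr0 addr0.
  rewrite addrAC [x + 1 - 1]addrAC !(pospowD _ (x - 1)) !(pospow_gt0E _ u0).
  rewrite powRr1 ?(ltW u0)// [leLHS]mulrC.
  rewrite (le_trans (ler_wpM2r (powR_ge0 _ _) (young_powR x0 u0 s01)))//.
  by apply: le_of_eq; ring.
have x0' : x != 0 by rewrite gt_eqF.
rewrite Euler_GammaS// powRB ?x0' ?implybT// powRr1 ?(ltW x0)//.
by by apply: le_of_eq; field.
Qed.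

(** On [(0, 1]], compare with the value [1] at [1] by [Euler_Gamma_wendel]; then climb by
    the functional equation. *)
Lemma Euler_Gamma_gt0 x : 0 < x -> 0 < Euler_Gamma x.
Proof.
move=> x0.
have gt0 y : 0 < y <= 1 -> 0 < Euler_Gamma y.
  move=> /andP[y0 y1]; have := @Euler_Gamma_wendel y (1 - y) y0.
  rewrite addrCA subrr addr0 Euler_Gamma1 subr_ge0 y1 gerBl ltW// => /(_ erefl).
  by move=> /(lt_le_trans ltr01); rewrite pmulr_rgt0// powR_gt0.
have [n xn] : exists n : nat, x <= n.+1%:R.
  by exists (Num.truncn x); rewrite ltW// truncnS_gt.
elim: n => [|n IHn] in x x0 xn *; first by apply: gt0; rewrite x0.
have [x1|x1] := leP x 1; first by apply: gt0; rewrite x0.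
have x10 : 0 < x - 1 by rewrite subr_gt0.
rewrite -[x](subrK 1) Euler_GammaS// mulr_gt0// IHn//.
by rewrite lerBlDr natr1.
Qed.

End Euler_Gamma.

(** * The reflection formula *)
Section Gamma_ratio.
Context {R : realType}.
Implicit Types (x y t : R) (n k : nat).

(** Two uses of the inequality above bound the ratio from above, and two others,
    shifted so that [K + x] and [K - x] occur on their larger side, from
    below.  The statement is about an arbitrary function [G] so that
    the definition of [Euler_Gamma] is never unfolded in the computation. *)
Lemma wendel_ratio_bound (G : R -> R) (K x : R) :
  (forall y, 0 < y -> 0 < G y) -> (forall y, 0 < y -> G (y + 1) = y * G y) ->
  (forall y s, 0 < y -> 0 <= s <= 1 -> G (y + s) <= y `^ s * G y) ->
  1 < K -> 0 < x < 1 ->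
  K / (K + 1) <= G (K + x) * G (K - x) / G K ^+ 2
  <= K / (K - 1).
Proof.
move=> G_gt0 GS wendel K1 /andP[x0 x1].
have K0 : 0 < K by lra.
have K10 : 0 < K - 1 by lra.
have GK : 0 < G K by rewrite G_gt0.
have GKE : G K = (K - 1) * G (K - 1).
  by rewrite -GS// subrK.
have x01 : 0 <= x <= 1 by rewrite !ltW.
have x01' : 0 <= 1 - x <= 1 by lra.
have Kx : 0 < K - x by lra.
have Kx' : 0 < K + x by lra.
have G1 := G_gt0 _ Kx; have G2 := G_gt0 _ Kx'.
rewrite ler_pdivlMr ?ler_pdivrMr ?exprn_gt0//; apply/andP; split.
- have H1 := wendel _ _ Kx' x01'.
  have H2 := wendel _ _ Kx x01.
  rewrite subrK in H2; rewrite (_ : K + x + (1 - x) = K + 1) in H1; last by ring.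
  rewrite GS// in H1.
  have H3 : (K + x) `^ (1 - x) <= (K + 1) `^ (1 - x).
    by apply: ge0_ler_powR; rewrite ?nnegrE; lra.
  have H4 : (K - x) `^ x <= (K + 1) `^ x.
    by apply: ge0_ler_powR; rewrite ?nnegrE; lra.
  have H5 : (K + 1) `^ (1 - x) * (K + 1) `^ x = K + 1.
    rewrite -powRD ?subrK ?powRr1//; first lra.
    by rewrite (_ : (K + 1 != 0)) ?implybT// gt_eqF// addr_gt0.
  rewrite mulrAC ler_pdivrMr ?addr_gt0// expr2 mulrA.
  have KG0 : 0 <= K * G K by rewrite mulr_ge0 ?ltW.
  rewrite (le_trans (ler_pM KG0 (ltW GK) H1 H2))//.
  rewrite mulrACA mulrC; apply: ler_wpM2l; first by rewrite mulr_ge0 ?ltW.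
  by rewrite (le_trans (ler_pM (powR_ge0 _ _) (powR_ge0 _ _) H3 H4))// H5.
- have H1 := wendel _ _ K0 x01.
  have H2 := wendel _ _ K10 x01'.
  rewrite (_ : K - 1 + (1 - x) = K - x) in H2; last by ring.
  have H3 : (K - 1) `^ (1 - x) <= K `^ (1 - x).
    by apply: ge0_ler_powR; rewrite ?nnegrE; lra.
  have H5 : K `^ x * K `^ (1 - x) = K.
    rewrite -powRD ?[x + _]addrC ?subrK ?powRr1//; first lra.
    by rewrite (_ : K != 0) ?implybT// gt_eqF.
  have -> : K / (K - 1) * G K ^+ 2 =
      K * (G K * G (K - 1)).
    by rewrite expr2 GKE; field; rewrite gt_eqF.
  have G0 : 0 < G (K - 1) by rewrite G_gt0.
  rewrite (le_trans (ler_pM (ltW G2) (ltW G1) H1 H2))//.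
  rewrite mulrACA; apply: ler_wpM2r; first by rewrite mulr_ge0 ?ltW.
  by rewrite -[leRHS]H5; apply: ler_wpM2l; rewrite ?powR_ge0.
Qed.

Definition Gamma_ratio k x : R :=
  Euler_Gamma (k.+1%:R + x) * Euler_Gamma (k.+1%:R - x) / Euler_Gamma k.+1%:R ^+ 2.

Lemma Gamma_ratio_cvg x : 0 < x < 1 -> Gamma_ratio k.+1 x @[k --> \oo] --> (1 : R).
Proof.
move=> x01.
apply: (@squeeze_cvgr _ _ _ _ (fun k => 1 - (k.+1%:R^-1)) (fun k => 1 + k.+1%:R^-1)).
- apply: nearW => k.
  have k0 : 0 < k.+1%:R :> R by rewrite ltr0n.
  have K1 : 1 < k.+2%:R :> R by rewrite ltr1n.
  have /andP[H1 H2] := wendel_ratio_bound (@Euler_Gamma_gt0 R) (@Euler_GammaS R)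
    (@Euler_Gamma_wendel R) K1 x01.
  have E : k.+2%:R = k.+1%:R + 1 :> R by rewrite natr1.
  rewrite /Gamma_ratio (le_trans _ H1)/= ?(le_trans H2)// E;
    move: k.+1%:R k0 {H1 H2 E} => /= K K0.
    rewrite addrK (_ : _ / _ = 1 + K^-1)//; by field; rewrite gt_eqF.
  rewrite -subr_ge0 (_ : _ - _ = 2 / (K * (K + 1 + 1))); last first.
    by field; rewrite !gt_eqF//; lra.
  by rewrite divr_ge0// mulr_ge0//; lra.
- rewrite -[X in _ --> X]subr0; apply: cvgB; first exact: cvg_cst.
  exact: cvg_harmonic.
- rewrite -[X in _ --> X]addr0; apply: cvgD; first exact: cvg_cst.
  exact: cvg_harmonic.
Qed.
End Gamma_ratio.

Section reflection.
Context {R : realType}.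
Notation leb := (@lebesgue_measure R).
Implicit Types (x y t : R) (n k : nat).

Let has_integral_ge0_itv (f : R -> R) t v : (forall r, 0 <= r <= t -> 0 <= f r) ->
  has_integral leb (fun r => \1_(`]0, t]) r * f r) v -> 0 <= v.
Proof.
move=> f0; apply: has_integral_ge0 => r; rewrite indic_itv_ocE.
have [/andP[r0 rt]|] := boolP (0 < r <= t); last by rewrite mul0r.
by rewrite mulr_ge0// f0// rt ltW.
Qed.

(** Like the next two, this inequality is the integral of a nonnegative function. *)
Lemma ge0_sin_le t : 0 <= t -> sin t <= t.
Proof.
move=> t0; rewrite -subr_ge0.
have := @has_integral_FTC2 R (fun r => r - sin r) (fun r => 1 - cos r) 0 t t0.
rewrite sin0 !subr0 => H; apply: (has_integral_ge0_itv _ (H _ _)).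
- by move=> r _; rewrite subr_ge0 cos_le1.
- by move=> r _; exact: is_derive_continuous.
Qed.

Lemma cos_ge_quadratic y : 1 - cos y <= y ^+ 2 / 2.
Proof.
wlog y0 : y / 0 <= y.
  move=> H; have [/H//|y0] := leP 0 y.
  by rewrite -cosN -sqrrN H// oppr_ge0 ltW.
rewrite -subr_ge0.
have := @has_integral_FTC2 R (fun r => r ^+ 2 / 2 - (1 - cos r)) (fun r => r - sin r) 0 y y0.
rewrite cos0 expr0n/= mul0r !subrr subr0 => H; apply: (has_integral_ge0_itv _ (H _ _)).
- by move=> r /andP[r0 _]; rewrite subr_ge0 ge0_sin_le.
- by move=> r _; apply: is_derive_eq; rewrite /GRing.scale /=; field.
- by move=> r _; exact: is_derive_continuous.
Qed.

Lemma mul_cos_le_sin t : 0 <= t <= pi -> t * cos t <= sin t.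
Proof.
move=> /andP[t0 tpi]; rewrite -subr_ge0.
have := @has_integral_FTC2 R (fun r => sin r - r * cos r) (fun r => r * sin r) 0 t t0.
rewrite sin0 mul0r !subr0 => H; apply: (has_integral_ge0_itv _ (H _ _)).
- move=> r /andP[r0 rt]; rewrite mulr_ge0// sin_ge0_pi// r0.
  exact: le_trans tpi.
- by move=> r _; apply: is_derive_eq; rewrite /GRing.scale /=; ring.
- by move=> r _; exact: is_derive_continuous.
Qed.

#[local] Instance is_derive_cosX n x :
  is_derive x 1 (fun t : R => cos t ^+ n) (n%:R * cos x ^+ n.-1 * - sin x).
Proof.
have -> : (fun t : R => cos t ^+ n) = (cos ^+ n)%R.
  by apply/funext => t; rewrite fctE.
exact: is_deriveX.
Qed.

Definition cosine_integral n x : R :=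
  fine (\int[leb]_t (\1_(`]0, pi / 2]) t * (cos t ^+ n * cos (2 * x * t)))%:E)%E.

Let pi2_ge0 : 0 <= pi / 2 :> R.
Proof. by rewrite divr_ge0// pi_ge0. Qed.

Let continuous_has_integral (f : R -> R) : continuous f ->
  exists v, has_integral leb (fun t => \1_(`]0, pi / 2]) t * f t) v.
Proof.
move=> cf; have fi : leb.-integrable `]0, pi / 2] (EFin \o f).
  have : leb.-integrable `[0, pi / 2] (EFin \o f).
    apply: continuous_compact_integrable => //; first exact: segment_compact.
    by apply: continuous_in_subspaceT => t _; exact: cf.
  by apply: integrableS => //; apply: subset_itv; rewrite bnd_simp.
exists (fine (\int[leb]_(t in `]0%R, (pi / 2)%R]) (f t)%:E)%E).
by apply: has_integral_indic => //; rewrite fineK//; exact: integrable_fin_num.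
Qed.

Lemma cosine_integral_has n x : has_integral leb
  (fun t => \1_(`]0, pi / 2]) t * (cos t ^+ n * cos (2 * x * t))) (cosine_integral n x).
Proof.
have [|v xv] := @continuous_has_integral (fun t => cos t ^+ n * cos (2 * x * t)).
  by move=> t; exact: is_derive_continuous.
by rewrite /cosine_integral xv.2.
Qed.

(** With [m = n + 2] and [y = 2 * x], the function
    [m * cos t ^+ (m - 1) * sin t * cos (y * t) - y * cos t ^+ m * sin (y * t)] vanishes at
    both ends, and its derivative is the combination of the two integrands. *)
Lemma cosine_integral_rec n x :
  ((n.+2)%:R ^+ 2 - 4 * x ^+ 2) * cosine_integral n.+2 x =
  n.+2%:R * n.+1%:R * cosine_integral n x.
Proof.
set m : R := n.+2%:R; set y := 2 * x.
pose F t := m * (cos t ^+ n.+1 * sin t * cos (y * t)) - y * (cos t ^+ n.+2 * sin (y * t)).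
pose f t := (m ^+ 2 - 4 * x ^+ 2) * (cos t ^+ n.+2 * cos (y * t))
  - m * n.+1%:R * (cos t ^+ n * cos (y * t)).
have dF t : is_derive t 1 F (f t).
  apply: is_derive_eq; rewrite /f /GRing.scale /=.
  have -> : cos t ^+ n.+2 = cos t ^+ n * (1 - sin t ^+ 2).
    by rewrite -cos2sin2 -exprD addn2.
  have -> : cos t ^+ n.+1 * cos t = cos t ^+ n * (1 - sin t ^+ 2).
    by rewrite -exprSr -cos2sin2 -exprD addn2.
  rewrite /= /m /y -[n.+2]addn1 natrD [cos t ^+ n.+1]exprS; ring.
have H := @has_integral_FTC2 R F f 0 (pi / 2) pi2_ge0 (fun t _ => dF t).
have {H} H : has_integral leb (fun t => \1_(`]0, pi / 2]) t * f t) (F (pi / 2) - F 0).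
  apply: H => t _; exact: is_derive_continuous.
have : F (pi / 2) - F 0 = 0.
  rewrite /F cos_pihalf !expr0n mulr0 sin0 /=; ring.
move=> FE; apply/eqP; rewrite -subr_eq0 -FE; apply/eqP.
apply: has_integral_unique H.
apply: has_integralP (has_integralB
  (has_integralZ (m ^+ 2 - 4 * x ^+ 2) (cosine_integral_has n.+2 x))
  (has_integralZ (m * n.+1%:R) (cosine_integral_has n x))) => // t.
rewrite /f; ring.
Qed.

Lemma cosine_integral0 x : x != 0 -> cosine_integral 0 x = sin (pi * x) / (2 * x).
Proof.
move=> x0; apply: (has_integral_unique (cosine_integral_has 0 x)).
have H := @has_integral_FTC2 R (fun t => sin (2 * x * t) / (2 * x))
  (fun t => cos (2 * x * t)) 0 (pi / 2) pi2_ge0.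
apply: has_integralP (H _ _) => [t||t _|t _].
- by rewrite expr0 mul1r.
- by rewrite mulr0 sin0 mul0r subr0; congr (sin _ / _); field.
- by apply: is_derive_eq; rewrite /GRing.scale /=; field.
- exact: is_derive_continuous.
Qed.

Lemma cosine_integral00 : cosine_integral 0 0 = pi / 2.
Proof.
apply: (has_integral_unique (cosine_integral_has 0 0)).
have H := @has_integral_FTC2 R idfun (fun t => 1) 0 (pi / 2) pi2_ge0.
apply: has_integralP (H _ _) => [t||t _].
- by rewrite expr0 mulr0 mul0r cos0 mul1r.
- by rewrite subr0.
- exact: cvg_cst.
Qed.

Definition even_cosine_integral k x : R := cosine_integral (k.*2) x.
Notation w := even_cosine_integral.

Lemma even_cosine_integral_rec k x :
  (k.+1%:R ^+ 2 - x ^+ 2) * w k.+1 x = k.+1%:R * (k.+1%:R - 2^-1) * w k x.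
Proof.
have := cosine_integral_rec k.*2 x; rewrite -doubleS -/(w k x) -/(w k.+1 x).
have -> : (k.*2.+1)%:R = 2 * k.+1%:R - 1 :> R.
  by rewrite -[k.*2.+1]addn1 -[k.+1]addn1 -muln2 !natrD natrM; ring.
rewrite -muln2 natrM => E.
apply: (mulfI (_ : 4 != 0)) => //.
transitivity (((k.+1%:R * 2) ^+ 2 - 4 * x ^+ 2) * w k.+1 x); first by ring.
by rewrite E; field.
Qed.

Lemma even_cosine_integral_gt0 k : 0 < w k 0.
Proof.
elim: k => [|k IHk]; first by rewrite /even_cosine_integral cosine_integral00 divr_gt0// pi_gt0.
have k0 : 0 < k.+1%:R :> R by rewrite ltr0n.
have k2 : 0 < k.+1%:R - 2^-1 :> R.
  have : 1 <= k.+1%:R :> R by rewrite ler1n.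
  by lra.
have := even_cosine_integral_rec k 0; rewrite expr0n/= subr0 => E.
have : 0 < k.+1%:R ^+ 2 * w k.+1 0 by rewrite E !mulr_gt0.
by rewrite pmulr_rgt0// exprn_gt0.
Qed.

Lemma even_cosine_integral_le k x : w k x <= w k 0.
Proof.
apply: (le_has_integral (cosine_integral_has _ _) (cosine_integral_has _ _)) => t.
rewrite ler_wpM2l ?indic_itv_ocE// ler_wpM2l ?mulr0 ?mul0r ?cos0 ?cos_le1//.
by rewrite exprn_even_ge0 ?odd_double.
Qed.

(** Bounding [1 - cos] by a square and [t * cos t] by [sin t] makes the difference
    comparable with the decrease of [w _ 0] from [k] to [k + 1], which the
    recurrence shows to be small relative to [w k.+1 0]. *)
Lemma even_cosine_integral_ge k x : w k.+1 0 - w k.+1 x <= 2 * x ^+ 2 * (w k 0 - w k.+1 0).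
Proof.
have H1 := has_integralB (cosine_integral_has k.+1.*2 0) (cosine_integral_has k.+1.*2 x).
have H2 := has_integralZ (2 * x ^+ 2)
  (has_integralB (cosine_integral_has k.*2 0) (cosine_integral_has k.+1.*2 0)).
apply: (le_has_integral H1 H2) => t.
rewrite -!mulrBr indic_itv_ocE.
have [/andP[t0 tpi]|_] := boolP (0 < t <= pi / 2); last by rewrite !mul0r mulr0.
rewrite !mul1r mulr0 mul0r cos0 !mulr1.
have -> : cos t ^+ k.*2 - cos t ^+ k.+1.*2 = cos t ^+ k.*2 * sin t ^+ 2.
  by rewrite sin2cos2 doubleS -[k.*2.+2]addn2 exprD; ring.
have -> : cos t ^+ k.+1.*2 * (1 - cos (2 * x * t)) =
    cos t ^+ k.*2 * (cos t ^+ 2 * (1 - cos (2 * x * t))).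
  by rewrite doubleS -[k.*2.+2]addn2 exprD; ring.
rewrite [leRHS]mulrCA ler_wpM2l//; first by rewrite exprn_even_ge0 ?odd_double.
rewrite (le_trans (ler_wpM2l (sqr_ge0 _) (cos_ge_quadratic _)))//.
have -> : cos t ^+ 2 * ((2 * x * t) ^+ 2 / 2) = 2 * x ^+ 2 * (t * cos t) ^+ 2 by field.
have tpi' : t <= pi.
  by rewrite (le_trans tpi)// ler_pdivrMr// ler_peMr ?pi_ge0// ler1n.
apply: ler_wpM2l; first by rewrite mulr_ge0// sqr_ge0.
rewrite lerXn2r// ?nnegrE.
- rewrite mulr_ge0 ?(ltW t0)// cos_ge0_pihalf//.
  by rewrite tpi andbT (le_trans _ (ltW t0))// oppr_le0.
- by rewrite sin_ge0_pi// ltW.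
- by rewrite mul_cos_le_sin// ltW.
Qed.

Lemma even_cosine_integral_ratio_cvg x : w k.+1 x / w k.+1 0 @[k --> \oo] --> (1 : R).
Proof.
apply: (@squeeze_cvgr _ _ _ _ (fun k => 1 - 2 * x ^+ 2 * (k.+1%:R^-1)) (fun=> 1)).
- apply: nearW => k; apply/andP; split; last first.
    by rewrite ler_pdivrMr ?even_cosine_integral_gt0// mul1r even_cosine_integral_le.
  rewrite ler_pdivlMr ?even_cosine_integral_gt0// mulrBl mul1r lerBlDl -lerBlDr.
  rewrite (le_trans (even_cosine_integral_ge k x))//.
  rewrite -[leRHS]mulrA; apply: ler_wpM2l; first by rewrite mulr_ge0// sqr_ge0.
  have := even_cosine_integral_rec k 0; rewrite expr0n/= subr0 expr2 -!mulrA => /mulfI -/(_ _)E.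
  have k1 : 1 <= k.+1%:R :> R by rewrite ler1n.
  have /E {E} : k.+1%:R != 0 :> R by rewrite pnatr_eq0.
  have := even_cosine_integral_gt0 k; move: k1; move: (w k 0) (w k.+1 0) k.+1%:R => A B K K1 A0 E.
  have K0 : K != 0 by rewrite gt_eqF// (lt_le_trans ltr01).
  have -> : B = (K - 2^-1) * A / K by rewrite -E mulrC mulKf.
  rewrite -subr_ge0.
  have -> : K^-1 * ((K - 2^-1) * A / K) - (A - (K - 2^-1) * A / K) =
     (2^-1 * K - 2^-1) * A / (K * K) by field.
  by rewrite divr_ge0 ?mulr_ge0 ?(ltW A0)//; lra.
- rewrite -[X in _ --> X]subr0; apply: cvgB; first exact: cvg_cst.
  by rewrite -[X in _ --> X](mulr0 (2 * x ^+ 2)); apply: cvgMr; exact: cvg_harmonic.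
- exact: cvg_cst.
Qed.

(** The factor [(k + 1)^2 - x^2] appears in the recurrence of the cosine integrals and, inverted,
    in that of the Gamma ratio. *)
Lemma cosine_Gamma_ratio_const k x : 0 < x < 1 ->
  w k x / w k 0 * Gamma_ratio k x = w 0 x / w 0 0 * Gamma_ratio 0 x.
Proof.
move=> /andP[x0 x1]; elim: k => [|k IHk]; [reflexivity|rewrite -IHk {IHk}].
have K1 : 1 <= k.+1%:R :> R by rewrite ler1n.
have wx := even_cosine_integral_rec k x; have w0 := even_cosine_integral_rec k 0.
rewrite expr0n/= subr0 in w0.
have wk0 := gt_eqF (even_cosine_integral_gt0 k).
have wk10 := gt_eqF (even_cosine_integral_gt0 k.+1).
rewrite /Gamma_ratio -[k.+2%:R]natr1 addrAC [k.+1%:R + 1 - x]addrAC.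
move: k.+1%:R K1 wx w0 => K K1 wx w0.
have K0 : 0 < K by rewrite (lt_le_trans ltr01).
have Kx : 0 < K - x by rewrite subr_gt0 (lt_le_trans x1).
have Kx' : 0 < K + x by rewrite addr_gt0.
rewrite !Euler_GammaS//.
have GK := gt_eqF (Euler_Gamma_gt0 K0).
move: (Euler_Gamma K) (Euler_Gamma (K + x)) (Euler_Gamma (K - x)) GK => G1 G2 G3 GK.
move: (w k x) (w k 0) (w k.+1 x) (w k.+1 0) wx w0 wk0 wk10 => A A0 B B0 wx w0 wk0 wk10.
have Kn0 : K != 0 by rewrite gt_eqF.
have -> : A / A0 = (K ^+ 2 - x ^+ 2) * B / (K ^+ 2 * B0).
  have K21 : K * 2 - 1 != 0 by rewrite gt_eqF//; lra.
  by rewrite wx w0; field; rewrite wk0 Kn0 K21.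
by field; rewrite wk10 GK Kn0.
Qed.

(** The constant of [cosine_Gamma_ratio_const] is [1], the limit of its two factors. *)
Lemma Gamma_reflection01 x : 0 < x < 1 ->
  Euler_Gamma (1 + x) * Euler_Gamma (1 - x) * sin (pi * x) = pi * x.
Proof.
move=> x01; have /andP[x0 x1] := x01.
have H : w 0 x / w 0 0 * Gamma_ratio 0 x = 1.
  have cv : w k.+1 x / w k.+1 0 * Gamma_ratio k.+1 x @[k --> \oo] --> (1 : R).
    rewrite -[X in _ --> X]mulr1; apply: cvgM; last exact: Gamma_ratio_cvg.
    exact: even_cosine_integral_ratio_cvg.
  have cv' : w k.+1 x / w k.+1 0 * Gamma_ratio k.+1 x @[k --> \oo] -->
     w 0 x / w 0 0 * Gamma_ratio 0 x.
    by under eq_cvg do rewrite cosine_Gamma_ratio_const//; exact: cvg_cst.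
  exact: (cvg_unique _ cv' cv).
move: H; rewrite /even_cosine_integral cosine_integral0 ?gt_eqF// cosine_integral00.
rewrite /Gamma_ratio Euler_Gamma1 expr1n divr1 => H.
have p0 := @pi_gt0 R.
move: (Euler_Gamma (1 + x)) (Euler_Gamma (1 - x)) (sin _) H => G1 G2 S H.
rewrite -[RHS]mulr1 -[X in _ = _ * X]H.
move: (pi : R) p0 => p p0; field; by rewrite !gt_eqF.
Qed.

(** The shift by [1] makes both arguments positive for [|x| < 1] and both sides odd in
    [x], so that negative exponents need no separate formula later. *)
Lemma Gamma_reflection x : -1 < x < 1 ->
  Euler_Gamma (1 + x) * Euler_Gamma (1 - x) * sin (pi * x) = pi * x.
Proof.
move=> /andP[xN1 x1]; have [x0|x0|->] := ltgtP x 0.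
- have := @Gamma_reflection01 (- x); rewrite oppr_gt0 x0 ltrNl xN1 opprK => /(_ erefl).
  rewrite !mulrN sinN mulrN => /oppr_inj E.
  by rewrite [Euler_Gamma (1 + x) * _]mulrC E.
- by apply: Gamma_reflection01; rewrite x0.
- by rewrite mulr0 sin0 mulr0.
Qed.
End reflection.

Section Gamma_negative.
Context {R : realType}.
Implicit Types (h : R).

Lemma Gamma_gt0E h : 0 < h -> Gamma h = Euler_Gamma h.
Proof. by rewrite /Gamma => ->. Qed.

Lemma Gamma_opp01 h : 0 < h < 1 -> Gamma (- h) = - (Euler_Gamma (1 - h) / h).
Proof.
move=> /andP[h0 h1].
have fl : Num.floor (- h) = -1 by apply: floor_def; rewrite intrD; lra.
rewrite /Gamma ifN; last by rewrite -leNgt oppr_le0 ltW.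
rewrite fl [absz _](_ : _ = 1%N)// big_ord1 addr0 [- h + _]addrC.
by move: (Euler_Gamma _) => G; field; rewrite gt_eqF.
Qed.

Lemma Gamma_opp12 h : 1 < h < 2 -> Gamma (- h) = Euler_Gamma (2 - h) / (h * (h - 1)).
Proof.
move=> /andP[h1 h2].
have fl : Num.floor (- h) = -2 by apply: floor_def; rewrite intrD; lra.
rewrite /Gamma ifN; last by rewrite -leNgt oppr_le0 ltW// (lt_trans ltr01).
rewrite fl big_ord_recl big_ord1 /= addr0 [- h + _]addrC.
have h10 : h - 1 != 0 by rewrite gt_eqF// subr_gt0.
have h0 : h != 0 by rewrite gt_eqF// (lt_trans ltr01).
move: (Euler_Gamma _) => G; rewrite /bump /=; field.
by rewrite h10 h0 addrC -opprB oppr_eq0 h10.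
Qed.
End Gamma_negative.

(** * Increments of a power against a power *)
Section kernel.
Context {R : realType}.
Notation leb := (@lebesgue_measure R).
Implicit Types (p q r s t u x y : R).

(** Multiply by [Euler_Gamma (1 - p)] and expand
    [Euler_Gamma (1 - p) * (r + y) `^ (p - 1)] as the integral of
    [l `^ (- p) * expR (- (l * (r + y)))] over [l > 0]; in the other order the inner
    integral over [y] is again a Gamma integral. *)
Lemma beta_integral p q r : p < 1 -> -1 < q -> p + q < 0 -> 0 < r ->
  has_integral leb (fun y => pospow (r + y) (p - 1) * pospow y q)
    (r `^ (p + q) * (Euler_Gamma (q + 1) * Euler_Gamma (- (p + q)) / Euler_Gamma (1 - p))).
Proof.
move=> p1 q1 pq r0.
have p1' : -1 < - p by rewrite ltrN2.
have pq' : -1 < - (p + q) - 1 by lra.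
have Gp : 0 < Euler_Gamma (1 - p) by rewrite Euler_Gamma_gt0// subr_gt0.
pose F (z : R * R) := pospow z.2 (- p) * expR (- (z.2 * (r + z.1))) * pospow z.1 q.
have mF : measurable_fun setT F.
  apply: measurable_funM; last exact: measurable_pospow_comp.
  apply: measurable_funM; first exact: measurable_pospow_comp.
  apply: (measurableT_comp (@measurable_expRN R)).
  by apply: measurable_funM => //; exact: measurable_funD.
have F0 z : 0 <= F z by rewrite !mulr_ge0 ?pospow_ge0// expR_ge0.
have F1 y : has_integral leb (fun l => F (y, l))
    (Euler_Gamma (1 - p) * (pospow (r + y) (p - 1) * pospow y q)).
  have [y0|y0] := ltP 0 y; last first.
    rewrite (pospow_le0E _ y0) !mulr0.
    apply: has_integralP (has_integral0 _) => // l; rewrite /F /=.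
    by rewrite (pospow_le0E _ y0) !mulr0.
  have ry : 0 < r + y by rewrite addr_gt0.
  apply: has_integralP (has_integralZ (pospow y q) (Gamma_scaled p1' ry)).
    by move=> l; rewrite /F/= mulrC [l * _]mulrC.
  rewrite (pospow_gt0E _ ry) [- p + 1]addrC opprB.
  by rewrite mulrC mulrA.
have F2 l : has_integral leb (fun y => F (y, l))
    (Euler_Gamma (q + 1) * (pospow l (- (p + q) - 1) * expR (- (r * l)))).
  have [l0|l0] := ltP 0 l; last first.
    rewrite (pospow_le0E _ l0) mul0r mulr0.
    apply: has_integralP (has_integral0 _) => // y; rewrite /F /=.
    by rewrite (pospow_le0E _ l0) !mul0r.
  apply: has_integralP (has_integralZ (pospow l (- p) * expR (- (r * l))) (Gamma_scaled q1 l0)).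
    by move=> y; rewrite /F/= mulrDr opprD expRD [l * r]mulrC; ring.
  have -> : - (p + q) - 1 = - p + - (q + 1) by ring.
  rewrite pospowD !(pospow_gt0E _ l0).
  by move: (Euler_Gamma _) => G; ring.
have := has_integralZ (Euler_Gamma (q + 1)) (Gamma_scaled pq' r0).
move=> /(@tonelli _ _ _ _ _ leb leb F _ _ _ mF F0 F1 F2).
move=> /(has_integralZ (Euler_Gamma (1 - p))^-1); apply: has_integralP => [y|].
  by rewrite mulKf// gt_eqF.
rewrite subrK opprK.
by move: (_ `^ _) (Euler_Gamma _) (Euler_Gamma _) (Euler_Gamma _) => *; ring.
Qed.

Definition increment_product p q u y : R :=
  (pospow (u + y) p - pospow y p) * pospow y q.

Let raw_const p q : R :=
  p / (p + q + 1) * (Euler_Gamma (q + 1) * Euler_Gamma (- (p + q)) / Euler_Gamma (1 - p)).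

(** For [y > 0] the increment is [p] times the integral of [(r + y) `^ (p - 1)]
    over [0 < r <= u], so that Tonelli's theorem and [beta_integral] apply. *)
Lemma increment_product_raw p q u : -1 < p < 1 -> -1 < q -> -1 < p + q < 0 -> 0 < u ->
  has_integral leb (increment_product p q u) (raw_const p q * u `^ (p + q + 1)).
Proof.
move=> /andP[pN1 p1] q1 /andP[pqN1 pq0] u0.
have [->|p0] := eqVneq p 0.
  rewrite /raw_const !mul0r; apply: has_integralP (has_integral0 _) => // y.
  rewrite /increment_product; have [y0|y0] := ltP 0 y.
    by rewrite !pospow_gt0E ?addr_gt0// !powRr0 subrr mul0r.
  by rewrite [pospow y q]pospow_le0E// mulr0.
have h0 : 0 < p + q + 1 by lra.
set C := Euler_Gamma (q + 1) * Euler_Gamma (- (p + q)) / Euler_Gamma (1 - p).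
pose F (z : R * R) := \1_(`]0, u]) z.2 * pospow (z.2 + z.1) (p - 1) * pospow z.1 q.
have mF : measurable_fun setT F.
  apply: measurable_funM; last exact: measurable_pospow_comp.
  apply: measurable_funM.
    by apply: (measurableT_comp (measurable_indic (measurable_itv _))).
  by apply: measurable_pospow_comp; exact: measurable_funD.
have F0 z : 0 <= F z by rewrite !mulr_ge0 ?pospow_ge0.
have F1 y : has_integral leb (fun r => F (y, r)) (p^-1 * increment_product p q u y).
  have [y0|y0] := ltP 0 y; last first.
    rewrite /increment_product (pospow_le0E q y0) !mulr0.
    apply: has_integralP (has_integral0 _) => // r; rewrite /F /=.
    by rewrite (pospow_le0E q y0) !mulr0.
  have := has_integralZ (pospow y q) (integral_pospow_pos (ltW u0) y0 p0).
  apply: has_integralP => [r|]; first by rewrite /F/= mulrC.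
  by rewrite /increment_product; ring.
have F2 r : has_integral leb (fun y => F (y, r)) (C * (\1_(`]0, u]) r * r `^ (p + q + 1 - 1))).
  rewrite /F/= indic_itv_ocE; have [/andP[r0 ru]|_] := boolP (0 < r <= u); last first.
    rewrite mul0r mulr0; apply: has_integralP (has_integral0 _) => // y.
    by rewrite !mul0r.
  rewrite addrK; apply: has_integralP (beta_integral p1 q1 pq0 r0) => [y|].
    by rewrite mul1r.
  by rewrite -/C mul1r mulrC.
have := has_integralZ C (integral_powR0 (ltW u0) h0).
move=> /(@tonelli _ _ _ _ _ leb leb F _ _ _ mF F0 F1 F2).
move=> /(has_integralZ p); apply: has_integralP => [y|]; first by rewrite mulVKf.
by rewrite /raw_const -/C; ring.
Qed.

(** The coefficient is written with [Gamma] at a negative argument because this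
    form persists beyond [p + q + 1 = 1], where the Beta integral
    diverges. *)
Definition power_const p q : R :=
  - Gamma (- (p + q + 1)) * (Euler_Gamma (1 + p) * Euler_Gamma (1 + q)) * (sin (pi * p) / pi).

Definition power_fun p q u : R :=
  power_const p q * pospow u (p + q + 1) + power_const q p * pospow (- u) (p + q + 1).

Let raw_constE p q : -1 < p < 1 -> -1 < p + q < 0 -> raw_const p q = power_const p q.
Proof.
move=> p11 /andP[pqN1 pq0].
have h : 0 < p + q + 1 < 1 by lra.
rewrite /raw_const /power_const Gamma_opp01// opprK.
have -> : 1 - (p + q + 1) = - (p + q) by ring.
have := Gamma_reflection p11; rewrite [1 + q]addrC.
have Gp : Euler_Gamma (1 - p) != 0.
  by rewrite gt_eqF// Euler_Gamma_gt0// subr_gt0; case/andP: p11.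
move: (Euler_Gamma (1 - p)) Gp (Euler_Gamma (1 + p)) => G1 G1n0 G2.
move: (Euler_Gamma (q + 1)) (Euler_Gamma (- (p + q))) => G3 G4.
move: (sin _) (@pi_gt0 R) => S; move: (pi : R) => P P0 E.
have {h}h0 : p + q + 1 != 0 by rewrite gt_eqF//; case/andP: h.
have Pn0 : P != 0 by rewrite gt_eqF.
have E' : G2 * (S / P) = p / G1.
  by rewrite -[p](mulKf Pn0) -E; field; rewrite Pn0 G1n0.
transitivity (G4 / (p + q + 1) * G3 * (G2 * (S / P))); last by field; rewrite h0 Pn0.
by rewrite E'; field; rewrite h0 G1n0.
Qed.

Let increment_product_pos p q u : -1 < p < 1 -> -1 < q -> -1 < p + q < 0 -> 0 < u ->
  has_integral leb (increment_product p q u) (power_const p q * u `^ (p + q + 1)).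
Proof.
move=> p11 q1 pq u0; rewrite -raw_constE//; exact: increment_product_raw.
Qed.

(** Shift by [u].  On the positive axis,
    [z `^ p * (z + u) `^ q - (z + u) `^ (p + q)] is the difference of the increment
    product with [p] and [q] exchanged and of the one with exponents [p + q] and [0]; the
    latter cancels against the integral over [(- u, 0]]. *)
Let increment_product_neg p q u : -1 < p < 1 -> -1 < q < 1 -> -1 < p + q < 0 -> 0 < u ->
  has_integral leb (increment_product p q (- u)) (power_const q p * u `^ (p + q + 1)).
Proof.
move=> /andP[pN1 p1] /andP[qN1 q1] /andP[pqN1 pq0] u0.
have h0 : 0 < p + q + 1 by lra.
have q11 : -1 < q < 1 by rewrite qN1.
have qp : -1 < q + p < 0 by rewrite addrC pqN1.
have pq11 : -1 < p + q < 1 by lra.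
have pq10 : -1 < p + q + 0 < 0 by rewrite addr0 pqN1.
have H1 := increment_product_pos q11 pN1 qp u0.
have H2 := increment_product_raw pq11 (ltrN10 _) pq10 u0.
have H3 := has_integral_shift u (integral_powR0 (ltW u0) h0).
have := has_integral_shift (- u) (has_integralB (has_integralB H1 H2) H3).
apply: has_integralP => [z|].
  rewrite indic_itv_ocE /increment_product !addrK [u + _]addrC subrK [- u + z]addrC.
  have [zu|zu] := ltP u z.
    have z0 : 0 < z by rewrite (lt_trans u0).
    have zu' : 0 < z - u by rewrite subr_gt0.
    rewrite [pospow (z - u) 0]pospow_gt0E// powRr0 andbF.
    by rewrite !pospowD /=; ring.
  have zu' : z - u <= 0 by rewrite subr_le0.
  rewrite !(pospow_le0E _ zu') andbT.
  have [z0|z0] := ltP 0 z; last by rewrite !(pospow_le0E _ z0) /=; ring.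
  by rewrite !(pospow_gt0E _ z0) powRD ?(gt_eqF z0) ?implybT//=; ring.
rewrite /raw_const !addr0 add0r Euler_Gamma1 (addrC q p).
have -> : 1 - (p + q) = - (p + q) + 1 by ring.
have Gpos : 0 < - (p + q) by lra.
rewrite Euler_GammaS//; have := gt_eqF (Euler_Gamma_gt0 Gpos).
move: (Euler_Gamma _) (power_const _ _) (u `^ _) => G M U Gn0.
by field; rewrite Gn0 (gt_eqF h0) (lt_eqF pq0).
Qed.

Lemma integral_increment_product p q u : -1 < p < 1 -> -1 < q < 1 -> -1 < p + q < 0 ->
  has_integral leb (increment_product p q u) (power_fun p q u).
Proof.
move=> p11 q11 pq; rewrite /power_fun; have [u0|u0|u0] := ltgtP u 0.
- have u0' : 0 < - u by rewrite oppr_gt0.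
  rewrite (pospow_le0E _ (ltW u0)) (pospow_gt0E _ u0') mulr0 add0r -{1}[u]opprK.
  exact: increment_product_neg.
- have u0' : - u <= 0 by rewrite oppr_le0 ltW.
  rewrite (pospow_le0E _ u0') (pospow_gt0E _ u0) mulr0 addr0.
  by apply: increment_product_pos => //; case/andP: q11.
- rewrite u0 oppr0 !pospow_le0E// !mulr0 addr0.
  apply: has_integralP (has_integral0 _) => // y.
  by rewrite /increment_product add0r subrr mul0r.
Qed.
End kernel.

(** * Products of two moving average kernels *)
Section kernel_product.
Context {R : realType}.
Notation leb := (@lebesgue_measure R).
Implicit Types (a b e r s t u x y : R).

(** The kernel of Mandelbrot and Van Ness, with [a] in the role of [H - 1/2]. *)
Definition mvn_kernel a t x : R := pospow (t - x) a - pospow (- x) a.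

Lemma measurable_mvn_kernel a t : measurable_fun setT (mvn_kernel a t).
Proof.
by apply: measurable_funB; apply: measurable_pospow_comp => //; exact: measurable_funB.
Qed.

(** The pattern is that of [C (t - s) - C t - C (- s)] for increments of a stationary
    field whose covariance [C] is only defined up to an infinite constant. *)
Definition kernel_covariance a b t s : R :=
  power_fun a b (t - s) - power_fun a b t - power_fun a b (- s).

Lemma power_fun0 a b : power_fun a b 0 = 0.
Proof. by rewrite /power_fun oppr0 !(pospow_le0E _ (lexx 0)) !mulr0 addr0. Qed.

Lemma power_funC a b u : power_fun b a u = power_fun a b (- u).
Proof. by rewrite /power_fun opprK addrC [b + a]addrC. Qed.

Lemma kernel_covarianceC a b t s : kernel_covariance b a s t = kernel_covariance a b t s.
Proof.
by rewrite /kernel_covariance !(power_funC a b) opprB opprK addrAC.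
Qed.

(** With [A r] and [B r] the translates at [r] of the two powers,
    [(A t - A 0) * (B s - B 0)] equals
    [(A t - A s) * B s - (A 0 - A s) * B s - (A t - A 0) * B 0]; each of these terms is a
    reflected increment product. *)
Lemma kernel_product_lt a b t s : -1 < a < 1 -> -1 < b < 1 -> -1 < a + b < 0 ->
  has_integral leb (fun x => mvn_kernel a t x * mvn_kernel b s x) (kernel_covariance a b t s).
Proof.
move=> a1 b1 ab.
have H u e := has_integral_reflect e (@integral_increment_product R a b u a1 b1 ab).
have := has_integralB (has_integralB (H (t - s) s) (H t 0)) (H (- s) s).
apply: has_integralP => // x.
rewrite /increment_product /mvn_kernel sub0r addrA subrK.
by rewrite [- s + _]addrA addNr sub0r; ring.
Qed.

Lemma has_integral_set1 a (f : R -> R) : measurable_fun setT f ->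
  has_integral leb (fun x => \1_[set a] x * f x) 0.
Proof.
move=> mf; apply: has_integral_indic => //; last by rewrite integral_set1.
apply: null_set_integrable; [by []| |exact: lebesgue_measure_set1].
by apply/measurable_EFinP; exact: measurable_funS mf.
Qed.

(** Reflecting [integral_pospow] exchanges the open and the closed end of the
    interval, which is repaired on two points. *)
Lemma integral_pospow_rev t e s : 0 < t -> 0 < e ->
  has_integral leb (fun r => \1_(`]0, t]) r * pospow (s - r) (e - 1))
    ((pospow s e - pospow (s - t) e) / e).
Proof.
move=> t0 e0.
have mf : measurable_fun setT (fun r => pospow (s - r) (e - 1)).
  by apply: measurable_pospow_comp; exact: measurable_funB.
have H := has_integral_reflect t (integral_pospow (t - s) (ltW t0) e0).
have := has_integralB (has_integralD H (has_integral_set1 t mf)) (has_integral_set1 0 mf).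
apply: has_integralP => [r|]; last by rewrite addr0 subr0 !opprB addrCA subrr addr0.
rewrite !indic_itv_ocE !indicE !classical_sets.in_set1.
rewrite (_ : t - r - (t - s) = s - r); last by ring.
rewrite subr_gt0 gerBl; move: (pospow _ _) => z.
have [->|rt] := eqVneq r t; first by rewrite ltxx lexx t0 (ltW t0) gt_eqF//=; ring.
have [->|r0] := eqVneq r 0; first by rewrite ltxx lexx t0/=; ring.
by rewrite lt_neqAle rt [0 < r]lt_neqAle eq_sym r0 /= andbC; ring.
Qed.

(** The passage from exponents [a - 1, b] to [a, b] is the functional equation of [Gamma] at
    [a] and at [- (a + b + 1)], and a half-period of the sine. *)
Lemma power_const_stepl a b : 0 < a < 1 -> 1 < a + b + 1 < 2 ->
  a / (a + b + 1) * power_const (a - 1) b = power_const a b.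
Proof.
move=> /andP[a0 a1] h12; have /andP[h1 h2] := h12.
rewrite /power_const (Gamma_opp12 h12).
have -> : a - 1 + b + 1 = a + b by ring.
have ab : 0 < a + b < 1 by lra.
rewrite (Gamma_opp01 ab) [1 + a]addrC Euler_GammaS//.
have -> : 1 + (a - 1) = a by ring.
have -> : 2 - (a + b + 1) = 1 - (a + b) by ring.
have -> : sin (pi * (a - 1)) = - sin (pi * a).
  by rewrite mulrBr mulr1 sinB sinpi cospi mulr0 subr0 mulrN1.
have ab0 : a + b != 0 by rewrite gt_eqF//; case/andP: ab.
have h0 : a + b + 1 != 0 by rewrite gt_eqF// (lt_trans ltr01).
move: (Euler_Gamma _) (Euler_Gamma _) (Euler_Gamma _) (sin _) (@pi_gt0 R) => G1 G2 G3 S.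
move: (pi : R) => P P0; field.
by rewrite addrK ab0 h0 gt_eqF.
Qed.

Lemma power_const_stepr a b : 0 < a < 1 -> 1 < a + b + 1 < 2 ->
  a / (a + b + 1) * power_const b (a - 1) = - power_const b a.
Proof.
move=> /andP[a0 a1] h12; have /andP[h1 h2] := h12.
rewrite /power_const [b + a]addrC (Gamma_opp12 h12).
have -> : b + (a - 1) + 1 = a + b by ring.
have ab : 0 < a + b < 1 by lra.
rewrite (Gamma_opp01 ab) [1 + a]addrC Euler_GammaS//.
have -> : 1 + (a - 1) = a by ring.
have -> : 2 - (a + b + 1) = 1 - (a + b) by ring.
have ab0 : a + b != 0 by rewrite gt_eqF//; case/andP: ab.
have h0 : a + b + 1 != 0 by rewrite gt_eqF// (lt_trans ltr01).
move: (Euler_Gamma _) (Euler_Gamma _) (Euler_Gamma _) (sin _) (@pi_gt0 R) => G1 G2 G3 S.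
move: (pi : R) => P P0; field.
by rewrite addrK ab0 h0 gt_eqF.
Qed.

Lemma integral_power_fun a b s t : 0 < t -> 0 < a + b ->
  has_integral leb (fun r => \1_(`]0, t]) r * power_fun b (a - 1) (s - r))
   ((power_const b (a - 1) * (pospow s (a + b + 1) - pospow (s - t) (a + b + 1))
    + power_const (a - 1) b * (pospow (t - s) (a + b + 1) - pospow (- s) (a + b + 1)))
      / (a + b + 1)).
Proof.
move=> t0 ab0; have h0 : 0 < a + b + 1 by rewrite addr_gt0.
have := has_integralD (has_integralZ (power_const b (a - 1)) (integral_pospow_rev s t0 h0))
  (has_integralZ (power_const (a - 1) b) (integral_pospow s (ltW t0) h0)).
apply: has_integralP => [r|]; last by ring.
rewrite /power_fun opprB (_ : b + (a - 1) + 1 = a + b + 1 - 1); last by ring.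
by ring.
Qed.

(** The kernel at [t] is [a] times the integral over [0 < r <= t] of
    [pospow (r - x) (a - 1)].  For fixed [r], the product of this power and the other kernel
    is a difference of two reflected increment products, with exponents
    [b] and [a - 1]. *)
Lemma kernel_product_pos a b t s : 0 < t -> 0 < a < 1 -> -1 < b < 1 -> 1 < a + b + 1 < 2 ->
  leb.-integrable setT (EFin \o (fun x => mvn_kernel a t x * mvn_kernel b s x)) ->
  has_integral leb (fun x => mvn_kernel a t x * mvn_kernel b s x) (kernel_covariance a b t s).
Proof.
move=> t0 a01 b1 h12 iQ; have /andP[a0 a1] := a01; have /andP[h1 h2] := h12.
pose F (z : R * R) := \1_(`]0, t]) z.2 * pospow (z.2 - z.1) (a - 1) * mvn_kernel b s z.1.
have mF : measurable_fun setT F.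
  apply: measurable_funM.
    apply: measurable_funM.
      by apply: (measurableT_comp (measurable_indic (measurable_itv _))).
    by apply: measurable_pospow_comp; exact: measurable_funB.
  exact: (measurableT_comp (measurable_mvn_kernel b s)).
have Fa c x : has_integral leb (fun r => \1_(`]0, t]) r * pospow (r - x) (a - 1) * c)
    (a^-1 * mvn_kernel a t x * c).
  have := has_integralZ c (integral_pospow x (ltW t0) a0).
  apply: has_integralP => [r|]; first by rewrite mulrC.
  by rewrite /mvn_kernel; ring.
have F1 x : has_integral leb (fun r => F (x, r)) (a^-1 * mvn_kernel a t x * mvn_kernel b s x).
  by apply: has_integralP (Fa (mvn_kernel b s x) x).
have a0' : -1 < a - 1 < 1 by lra.
have ab0' : -1 < b + (a - 1) < 0 by lra.
have F2 r : has_integral leb (fun x => F (x, r))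
    (\1_(`]0, t]) r * (power_fun b (a - 1) (s - r) - power_fun b (a - 1) (- r))).
  have H u := has_integral_reflect r (integral_increment_product u b1 a0' ab0').
  have HB := has_integralB (H (s - r)) (H (- r)).
  apply: has_integralP (has_integralZ (\1_(`]0, t]) r) HB) => // x.
  rewrite /F/= /increment_product /mvn_kernel addrA subrK.
  by rewrite [- r + _]addrA addNr sub0r; ring.
have F3 x : has_integral leb (fun r => `|F (x, r)|)
    (`|a^-1 * (mvn_kernel a t x * mvn_kernel b s x)|).
  apply: has_integralP (Fa `|mvn_kernel b s x| x) => [r|].
    rewrite /F/= !normrM; congr (_ * _); rewrite !ger0_norm ?pospow_ge0//.
  rewrite mulrA normrM; congr (_ * _); rewrite ger0_norm//.
  have := Fa 1 x; rewrite mulr1; apply: has_integral_ge0 => r.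
  by rewrite mulr1 mulr_ge0 ?pospow_ge0.
have iF : leb.-integrable setT
    (EFin \o (fun x => `|a^-1 * (mvn_kernel a t x * mvn_kernel b s x)|)).
  have [v xv] := integrable_has_integral iQ.
  by apply: integrable_norm; exact: (has_integralZ a^-1 xv).1.
have ab0 : 0 < a + b by lra.
have H0 := integral_power_fun 0 t0 ab0.
have Hs := integral_power_fun s t0 ab0.
have Hv := has_integralB Hs H0.
have {}Hv : has_integral leb (fun r => \1_(`]0, t]) r *
    (power_fun b (a - 1) (s - r) - power_fun b (a - 1) (- r))) (a^-1 * kernel_covariance a b t s).
  apply: has_integralP Hv => [r|]; first by rewrite sub0r mulrBr.
  have an0 : a != 0 by rewrite gt_eqF.
  apply: (mulfI an0); rewrite mulVKf//.
  rewrite /kernel_covariance /power_fun opprK opprB.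
  rewrite -(power_const_stepl a01 h12) -[power_const b a]opprK -(power_const_stepr a01 h12).
  rewrite sub0r subr0 oppr0 (pospow_le0E _ (lexx 0)).
  move: (power_const _ _) (power_const _ _) => M1 M2.
  by move: (pospow s _) (pospow (s - t) _) (pospow (t - s) _) (pospow (- s) _)
    (pospow t _) (pospow (- t) _) => *; ring.
have := has_integralZ a (@fubini_has_integral _ _ _ _ _ leb leb F _ _ _ _ mF F1 F2 F3 iF Hv).
by apply: has_integralP => [x|]; rewrite ?mulVKf ?gt_eqF// mulrA mulVKf// gt_eqF.
Qed.

Let half_lt1 a : - 2^-1 < a < 2^-1 -> -1 < a < 1.
Proof. by move=> /andP[a1 a2]; apply/andP; split; lra. Qed.

(** Supplied later by the existence of the Wiener integrals of the kernels. *)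
Definition kernel_products_integrable := forall a b t s,
  - 2^-1 < a < 2^-1 -> - 2^-1 < b < 2^-1 ->
  leb.-integrable setT (EFin \o (fun x => mvn_kernel a t x * mvn_kernel b s x)).

(** Negative [t] is moved to [- t] by translating the line: the kernel at [t] becomes
    minus the kernel at [- t], and the one at [s] becomes the difference of those
    at [s - t] and at [- t]. *)
Lemma kernel_product_gt a b t s : kernel_products_integrable ->
  0 < a < 2^-1 -> - 2^-1 < b < 2^-1 -> 0 < a + b ->
  has_integral leb (fun x => mvn_kernel a t x * mvn_kernel b s x) (kernel_covariance a b t s).
Proof.
move=> iQ a01 b1 ab.
have a11 : - 2^-1 < a < 2^-1 by move: a01 => /andP[a0 a1]; apply/andP; split; lra.
have h12 : 1 < a + b + 1 < 2 by move: a01 b1 => /andP[_ ?] /andP[_ ?]; apply/andP; split; lra.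
have a01' : 0 < a < 1 by move: a01 => /andP[a0 a1]; apply/andP; split; lra.
have pos r u : 0 < r -> has_integral leb (fun x => mvn_kernel a r x * mvn_kernel b u x)
    (kernel_covariance a b r u).
  by move=> r0; apply: kernel_product_pos => //; [exact: half_lt1|exact: iQ].
have [t0|t0|->] := ltgtP t 0; [|exact: pos|].
  have Nt : 0 < - t by rewrite oppr_gt0.
  have := has_integral_shift (- t) (has_integralB (pos _ (- t) Nt) (pos _ (s - t) Nt)).
  apply: has_integralP => [x|].
    rewrite /mvn_kernel (_ : - t - (x - t) = - x); last by ring.
    rewrite (_ : s - t - (x - t) = s - x); last by ring.
    by rewrite opprB; ring.
  rewrite /kernel_covariance !opprK addNr power_fun0.
  rewrite (_ : - t - (s - t) = - s) ?opprB; last by ring.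
  by ring.
rewrite /kernel_covariance sub0r power_fun0 subr0 subrr.
apply: has_integralP (has_integral0 _) => // x.
by rewrite {1}/mvn_kernel sub0r subrr mul0r.
Qed.

Lemma integral_kernel_product a b t s : kernel_products_integrable ->
  - 2^-1 < a < 2^-1 -> - 2^-1 < b < 2^-1 -> a + b != 0 ->
  has_integral leb (fun x => mvn_kernel a t x * mvn_kernel b s x) (kernel_covariance a b t s).
Proof.
move=> iQ a1 b1; have /andP[aN1 a2] := a1; have /andP[bN1 b2] := b1.
move=> /lt_total/orP[ab|ab].
  apply: kernel_product_lt; [exact: half_lt1|exact: half_lt1|].
  by rewrite ab andbT; lra.
have [a0|a0] := ltP 0 a; first by apply: kernel_product_gt => //; rewrite a0.
have b0 : 0 < b < 2^-1 by rewrite b2 andbT; lra.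
rewrite -kernel_covarianceC; apply: has_integralP (kernel_product_gt s t iQ b0 a1 _) => //.
  by move=> x; rewrite mulrC.
by rewrite addrC.
Qed.
End kernel_product.

Arguments kernel_products_integrable R : clear implicits.

(** * Continuity in the exponent *)
Section exponent_limit.
Context {R : realType}.
Notation leb := (@lebesgue_measure R).
Implicit Types (a b c e r s t u x y : R).

Lemma powR_le_sum b c x : `|b| <= c -> 0 < x -> x `^ b <= x `^ (- c) + x `^ c.
Proof.
rewrite ler_norml => /andP[cb bc] x0; have [x1|x1] := leP x 1.
  rewrite (@le_trans _ _ (x `^ (- c)))//; last by rewrite lerDl powR_ge0.
  by apply: ger_powR => //; rewrite x0.
rewrite (@le_trans _ _ (x `^ c))//; last by rewrite lerDr powR_ge0.
by apply: ler_powR => //; exact: ltW.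
Qed.

(** Both sides are integrals over [(x, y]] of derivatives, which
    [powR_le_sum] compares; the factors [|b|] and [c] are in the right order. *)
Let powR_diff_bound b c x y : 0 < c -> `|b| <= c -> 0 < x <= y ->
  `|y `^ b - x `^ b| <= `|y `^ (- c) - x `^ (- c)| + `|y `^ c - x `^ c|.
Proof.
move=> c0 bc /andP[x0 xy]; have [->|b0] := eqVneq b 0.
  by rewrite !powRr0 subrr normr0 addr_ge0.
have cn0 : c != 0 by rewrite gt_eqF.
have Ncn0 : - c != 0 by rewrite oppr_eq0.
have Hb := integral_powR_pos x0 xy b0.
have H := has_integralD (integral_powR_pos x0 xy Ncn0) (integral_powR_pos x0 xy cn0).
have pos p : p != 0 -> 0 <= (y `^ p - x `^ p) / p.
  move=> p0; apply: (has_integral_ge0 _ (integral_powR_pos x0 xy p0)) => r.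
  by rewrite mulr_ge0 ?powR_ge0.
have le : (y `^ b - x `^ b) / b <= (y `^ (- c) - x `^ (- c)) / - c + (y `^ c - x `^ c) / c.
  apply: (le_has_integral Hb H) => r; rewrite -mulrDr indic_itv_ocE.
  have [/andP[xr _]|_] := boolP (x < r <= y); last by rewrite !mul0r.
  have r0 : 0 < r by rewrite (lt_trans x0).
  rewrite !mul1r !powRD ?(gt_eqF r0) ?implybT// -mulrDl.
  by rewrite ler_wpM2r ?powR_ge0// powR_le_sum.
have nE p : p != 0 -> `|y `^ p - x `^ p| = (y `^ p - x `^ p) / p * `|p|.
  move=> p0; rewrite -{1}[y `^ p - x `^ p](divfK p0) normrM.
  by rewrite [`|_ / _|]ger0_norm// pos.
rewrite !nE// normrN (gtr0_norm c0) -mulrDl.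
by rewrite (le_trans (ler_wpM2r (normr_ge0 _) le))// ler_wpM2l// addr_ge0 ?pos.
Qed.

(** A dominating function that is independent of [b] and is itself made of kernels, so that its
    product with another kernel is integrable. *)
Lemma mvn_kernel_bound b c s x : 0 < c -> `|b| <= c ->
  `|mvn_kernel b s x| <= `|mvn_kernel (- c) s x| + `|mvn_kernel c s x|.
Proof.
move=> c0 bc; rewrite /mvn_kernel; move: (s - x) => y; move: (- x) => {s}x.
have single z : 0 < z -> `|z `^ b| <= `|z `^ (- c)| + `|z `^ c|.
  by move=> z0; rewrite !ger0_norm ?powR_ge0// powR_le_sum.
have [y0|y0] := ltP 0 y; have [x0|x0] := ltP 0 x.
- rewrite !pospow_gt0E//; have [xy|yx] := leP x y.
    by apply: powR_diff_bound => //; apply/andP.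
  rewrite distrC [`|y `^ (- c) - _|]distrC [`|y `^ c - _|]distrC.
  by apply: powR_diff_bound => //; apply/andP; split=> //; exact: ltW.
- by rewrite !(pospow_le0E _ x0) !subr0 !pospow_gt0E// single.
- by rewrite !(pospow_le0E _ y0) !sub0r !normrN !pospow_gt0E// single.
- by rewrite !(pospow_le0E _ x0) !(pospow_le0E _ y0) subrr normr0 addr_ge0.
Qed.

Lemma pospow_cvg x (e_ : nat -> R) e : e_ n @[n --> \oo] --> e ->
  pospow x (e_ n) @[n --> \oo] --> pospow x e.
Proof.
move=> ee; rewrite /pospow; case: ifPn => x0; last exact: cvg_cst.
rewrite /powR (gt_eqF x0).
have H : e_ n * ln x @[n --> \oo] --> e * ln x by apply: cvgMl.
exact: (cvg_comp _ _ H (@continuous_expR R (e * ln x))).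
Qed.

Lemma Euler_Gamma_cvg (x_ : nat -> R) x y z : 0 < y -> (forall n, y <= x_ n <= z) ->
  x_ n @[n --> \oo] --> x -> Euler_Gamma (x_ n) @[n --> \oo] --> Euler_Gamma x.
Proof.
move=> y0 xyz xx.
have x0 n : 0 < x_ n by rewrite (lt_le_trans y0)//; case/andP: (xyz n).
have z0 : 0 < z by case/andP: (xyz 0%N) => yx xz; rewrite (lt_le_trans y0)// (le_trans yx).
have lx : 0 < x.
  rewrite (lt_le_trans y0)// -(cvg_lim (@Rhausdorff R) xx).
  apply: limr_ge; first by apply/cvg_ex; exists x.
  by apply: nearW => n; case/andP: (xyz n).
have [||w xw vw] := @dominated_has_integral _ _ _ leb
  (fun n => Gamma_integrand (x_ n)) (Gamma_integrand x) _ _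
  (has_integralD (Gamma_has_integral y0) (Gamma_has_integral z0)).1 _
  (fun n => Gamma_has_integral (x0 n)).
- move=> n u; rewrite ger0_norm ?Gamma_integrand_ge0// /Gamma_integrand -mulrDl.
  rewrite ler_wpM2r ?expR_ge0// /pospow; case: ifPn => [u0|_]; last by rewrite addr0.
  have /andP[yx xz] := xyz n; have [u1|u1] := leP u 1.
    rewrite (@le_trans _ _ (u `^ (y - 1))) ?lerDl ?powR_ge0//.
    by apply: ger_powR; rewrite ?u0// lerD2r.
  rewrite (@le_trans _ _ (u `^ (z - 1))) ?lerDr ?powR_ge0//.
  by apply: ler_powR; [exact: ltW|rewrite lerD2r].
- move=> u; apply: cvgMl; apply: pospow_cvg.
  by apply: cvgB => //; exact: cvg_cst.
by rewrite (has_integral_unique (Gamma_has_integral lx) xw).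
Qed.

Lemma kernel_product_limit a b c (b_ : nat -> R) (v : nat -> R) t s :
  kernel_products_integrable R ->
  - 2^-1 < a < 2^-1 -> 0 < c < 2^-1 -> (forall n, `|b_ n| <= c) ->
  b_ n @[n --> \oo] --> b ->
  (forall n, has_integral leb (fun x => mvn_kernel a t x * mvn_kernel (b_ n) s x) (v n)) ->
  exists2 w, has_integral leb (fun x => mvn_kernel a t x * mvn_kernel b s x) w
    & v n @[n --> \oo] --> w.
Proof.
move=> iQ a1 /andP[c0 c1] bc bb vn.
have c1' : - 2^-1 < c < 2^-1 by apply/andP; split; lra.
have cN1' : - 2^-1 < - c < 2^-1 by apply/andP; split; lra.
have [w1 H1] := integrable_has_integral (integrable_norm (iQ a (- c) t s a1 cN1')).
have [w2 H2] := integrable_has_integral (integrable_norm (iQ a c t s a1 c1')).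
apply: (dominated_has_integral (has_integralD H1 H2).1 _ vn) => [n x|x].
  by rewrite /= !normrM -mulrDr ler_wpM2l// mvn_kernel_bound.
by apply: cvgMr; apply: cvgB; exact: pospow_cvg.
Qed.
End exponent_limit.

(** * Closed forms of the kernel integral *)
Section closed_forms.
Context {R : realType}.
Notation leb := (@lebesgue_measure R).
Implicit Types (H s t u x : R).

Lemma sin_half_shift H : sin (pi * (H - 2^-1)) = - cos (pi * H).
Proof.
by rewrite mulrBr sinB sin_pihalf cos_pihalf mulr0 mulr1 sub0r.
Qed.

Lemma pospow_sg h u : 0 < h ->
  2 * pospow u h = `|u| `^ h + Num.sg u * `|u| `^ h.
Proof.
move=> h0; have [u0|u0|->] := ltgtP u 0.
- by rewrite pospow_le0E ?(ltW u0)// ltr0_sg// mulr0 mulN1r subrr.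
- by rewrite pospow_gt0E// gtr0_sg// mul1r gtr0_norm//; ring.
- by rewrite pospow_le0E// sgr0 normr0 mul0r powR0 ?gt_eqF// addr0 mulr0.
Qed.

Definition Gamma_product H (H' : R) : R := Euler_Gamma (H + 2^-1) * Euler_Gamma (H' + 2^-1) / pi.

(** [pi * H] and [pi * H'] are the difference and the sum of
    [(H + H') * (pi / 2)] and [(H' - H) * (pi / 2)]; the addition formulas separate the part of
    [power_fun] that is even in [u] from the odd one. *)
Lemma power_fun_trig H (H' : R) u : 0 < H + H' ->
  power_fun (H - 2^-1) (H' - 2^-1) u = Gamma_product H H' * Gamma (- (H + H')) *
   (cos ((H' - H) * (pi / 2)) * cos ((H + H') * (pi / 2)) * `|u| `^ (H + H')
    + sin ((H' - H) * (pi / 2)) * sin ((H + H') * (pi / 2)) * (Num.sg u * `|u| `^ (H + H'))).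
Proof.
move=> h0; rewrite /power_fun /power_const /Gamma_product !sin_half_shift.
have -> : H - 2^-1 + (H' - 2^-1) + 1 = H + H' by field.
have -> : H' - 2^-1 + (H - 2^-1) + 1 = H + H' by field.
have -> : 1 + (H - 2^-1) = H + 2^-1 by field.
have -> : 1 + (H' - 2^-1) = H' + 2^-1 by field.
have -> : pi * H = (H + H') * (pi / 2) - (H' - H) * (pi / 2) by field.
have -> : pi * H' = (H + H') * (pi / 2) + (H' - H) * (pi / 2) by field.
rewrite cosB cosD.
have -> : pospow u (H + H') = 2^-1 * (`|u| `^ (H + H') + Num.sg u * `|u| `^ (H + H')).
  by rewrite -pospow_sg//; field.
have -> : pospow (- u) (H + H') = 2^-1 * (`|u| `^ (H + H') - Num.sg u * `|u| `^ (H + H')).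
  by rewrite -mulNr -sgrN -normrN -pospow_sg//; field.
move: (cos _) (cos _) (sin _) (sin _) => c1 c2 s1 s2.
move: (Gamma _) (Euler_Gamma _) (Euler_Gamma _) => G1 G2 G3.
move: (Num.sg u) (_ `^ _) (pi^-1) => S A P; by field.
Qed.

Lemma kernel_covariance_trig H (H' : R) t s : 0 < H + H' ->
  kernel_covariance (H - 2^-1) (H' - 2^-1) t s = Gamma_product H H' * Gamma (- (H + H')) *
   (cos ((H' - H) * (pi / 2)) * cos ((H + H') * (pi / 2)) *
      (`|t - s| `^ (H + H') - `|t| `^ (H + H') - `|s| `^ (H + H'))
    - sin ((H' - H) * (pi / 2)) * sin ((H + H') * (pi / 2)) *
      (Num.sg t * `|t| `^ (H + H') - Num.sg s * `|s| `^ (H + H')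
       - Num.sg (t - s) * `|t - s| `^ (H + H'))).
Proof.
move=> h0; rewrite /kernel_covariance !power_fun_trig// normrN sgrN.
move: (Gamma_product _ _ * _) (cos _ * cos _) (sin _ * sin _) => G C S.
by move: (_ `^ _) (_ `^ _) (_ `^ _) (Num.sg _) (Num.sg _) (Num.sg _) => *; ring.
Qed.

(** [`|u| `^ (- e)] as a function that is smooth in [e] even for [u = 0], where
    [ln 0 = 0]; the factor [`|u|] or [u] in front of it then makes the value right. *)
Definition log_factor u (e : R) : R := expR (- (e * ln `|u|)).

Lemma abs_powR_log u e : e < 1 -> `|u| `^ (1 - e) = `|u| * log_factor u e.
Proof.
move=> e1; rewrite /powR /log_factor.
case: ifPn => [/eqP->|u0]; first by rewrite mul0r gt_eqF// subr_gt0.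
rewrite mulrBl mul1r expRD lnK// posrE lt_neqAle eq_sym u0 normr_ge0//.
Qed.

Lemma sg_powR_log u e : e < 1 -> Num.sg u * `|u| `^ (1 - e) = u * log_factor u e.
Proof. by move=> e1; rewrite abs_powR_log// mulrA -numEsg. Qed.

(** The cofactor of [Gamma (- h)] in [kernel_covariance_trig] for [h = 1 - e], where
    the cosine and the sine of [h * (pi / 2)] become the sine and the cosine
    of [e * (pi / 2)]. *)
Definition covariance_numerator H H' t s (e : R) : R :=
  cos ((H' - e - H) * (pi / 2)) * sin (e * (pi / 2)) *
     (`|t - s| * log_factor (t - s) e - `|t| * log_factor t e - `|s| * log_factor s e)
  - sin ((H' - e - H) * (pi / 2)) * cos (e * (pi / 2)) *
     (t * log_factor t e - s * log_factor s e - (t - s) * log_factor (t - s) e).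

Lemma kernel_covariance_numerator H H' t s e : H + H' = 1 -> 0 < e < 1 ->
  kernel_covariance (H - 2^-1) (H' - e - 2^-1) t s =
    - (Gamma_product H (H' - e) * Euler_Gamma (1 + e) / (1 - e))
    * (covariance_numerator H H' t s e / e).
Proof.
move=> HH /andP[e0 e1].
have hE : H + (H' - e) = 1 - e by rewrite addrA HH.
have h01 : 0 < 1 - e < 1 by apply/andP; split; lra.
rewrite kernel_covariance_trig hE; last by case/andP: h01.
rewrite Gamma_opp01// !sg_powR_log// !abs_powR_log//.
have -> : cos ((1 - e) * (pi / 2)) = sin (e * (pi / 2)).
  by rewrite mulrBl mul1r cosB cos_pihalf sin_pihalf mul0r add0r mul1r.
have -> : sin ((1 - e) * (pi / 2)) = cos (e * (pi / 2)).
  by rewrite mulrBl mul1r sinB cos_pihalf sin_pihalf mul0r subr0 mul1r.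
rewrite (_ : 1 - (1 - e) = e); last by ring.
rewrite [1 + e]addrC Euler_GammaS// -/(covariance_numerator H H' t s e).
move: (covariance_numerator _ _ _ _ _) (Euler_Gamma e) (Gamma_product _ _) => N G P.
field; rewrite (gt_eqF e0) gt_eqF//; by case/andP: h01.
Qed.

Lemma covariance_numerator_derive H H' t s :
  is_derive (0 : R) (1 : R) (covariance_numerator H H' t s)
    (- (cos ((H' - H) * (pi / 2)) * (pi / 2) * (`|t| + `|s| - `|t - s|)
     - sin ((H' - H) * (pi / 2)) * (t * ln `|t| - s * ln `|s| - (t - s) * ln `|t - s|))).
Proof.
apply: is_derive_eq; rewrite /GRing.scale /= /log_factor.
rewrite !(mul0r, mulr0, oppr0, expR0, subr0, mulr1, cos0, sin0, addr0, add0r).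
move: (cos _) (sin _) => C S; move: (ln `|t|) (ln `|s|) (ln `|t - s|) => l1 l2 l3.
by move: `|t| `|s| `|t - s| (pi / 2) => *; ring.
Qed.

Lemma covariance_numerator0 H H' t s : covariance_numerator H H' t s 0 = 0.
Proof.
rewrite /covariance_numerator /log_factor !mul0r sin0 oppr0 expR0; ring.
Qed.

Lemma is_derive_seq_cvg (f : R -> R) df (e_ : nat -> R) : is_derive (0 : R) (1 : R) f df ->
  f 0 = 0 -> (forall n, e_ n != 0) -> e_ n @[n --> \oo] --> 0 ->
  f (e_ n) / e_ n @[n --> \oo] --> df.
Proof.
move=> [fd <-] f0 en0 e0.
have : h^-1 *: ((f \o shift 0) (h *: (1 : R)) - f 0) @[h --> 0^'] --> 'D_1 f 0 := fd.
move=> /cvgr_dnbhsP/(_ e_ (conj en0 e0)); apply: cvg_trans.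
apply: near_eq_cvg; apply: nearW => n /=.
by rewrite f0 subr0 addr0 /GRing.scale /= mulr1 mulrC.
Qed.

Definition log_covariance H H' t s : R :=
  cos ((H' - H) * (pi / 2)) * (pi / 2) * (`|t| + `|s| - `|t - s|)
  - sin ((H' - H) * (pi / 2)) * (t * ln `|t| - s * ln `|s| - (t - s) * ln `|t - s|).

(** The pole is resolved by [Gamma (- (1 - e)) = - Euler_Gamma (1 + e) / (e * (1 - e))]; the
    division by [e] turns the numerator into a difference quotient at [0]. *)
Lemma kernel_covariance_limit H H' t s (e_ : nat -> R) : H + H' = 1 -> 0 < H' ->
  (forall n, 0 < e_ n < 2^-1) -> e_ n @[n --> \oo] --> 0 ->
  kernel_covariance (H - 2^-1) (H' - e_ n - 2^-1) t s @[n --> \oo] -->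
  Gamma_product H H' * log_covariance H H' t s.
Proof.
move=> HH H'0 e01 e0.
have en0 n : e_ n != 0 by rewrite gt_eqF//; case/andP: (e01 n).
have cN := is_derive_seq_cvg (covariance_numerator_derive H H' t s)
  (covariance_numerator0 H H' t s) en0 e0.
have cG1 : Euler_Gamma (1 + e_ n) @[n --> \oo] --> (1 : R).
  rewrite -[X in _ --> X]Euler_Gamma1.
  apply: (@Euler_Gamma_cvg _ _ _ 1 2) => //.
    by move=> n; have := e01 n; move=> /andP[? ?]; apply/andP; split; lra.
  by rewrite -[X in _ --> X]addr0; apply: cvgD => //; exact: cvg_cst.
have cG2 : Euler_Gamma (H' - e_ n + 2^-1) @[n --> \oo] --> Euler_Gamma (H' + 2^-1).
  apply: (@Euler_Gamma_cvg _ _ _ H' (H' + 2^-1)) => //.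
    by move=> n; have := e01 n; move=> /andP[? ?]; apply/andP; split; lra.
  apply: cvgD; last exact: cvg_cst.
  by rewrite -[X in _ --> X]subr0; apply: cvgB => //; exact: cvg_cst.
have c1e : (1 - e_ n)^-1 @[n --> \oo] --> (1 : R).
  rewrite -[X in _ --> X]invr1; apply: cvgV; first exact: oner_neq0.
  by rewrite -[X in _ --> X]subr0; apply: cvgB => //; exact: cvg_cst.
have -> : Gamma_product H H' * log_covariance H H' t s =
   - (Euler_Gamma (H + 2^-1) * Euler_Gamma (H' + 2^-1) / pi * 1 * 1) * (- log_covariance H H' t s).
  by rewrite !mulr1 mulrNN.
under eq_cvg => n.
  rewrite kernel_covariance_numerator//; last first.
    by have /andP[-> e1] := e01 n; rewrite (lt_trans e1)// invf_lt1// ltr1n.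
  over.
apply: cvgM => //; apply: cvgN; apply: cvgM => //; apply: cvgM => //; apply: cvgMl.
by apply: cvgMr.
Qed.

(** The approximating exponents [b - e_ n] stay in [[- c, c]], where [c] lies
    halfway between [|b|] and [1/2]. *)
Lemma integral_kernel_product1 H H' t s : kernel_products_integrable R ->
  0 < H < 1 -> 0 < H' < 1 -> H + H' = 1 ->
  has_integral leb (fun x => mvn_kernel (H - 2^-1) t x * mvn_kernel (H' - 2^-1) s x)
    (Gamma_product H H' * log_covariance H H' t s).
Proof.
move=> iQ /andP[H0 H1] /andP[H'0 H'1] HH.
pose b := H' - 2^-1; pose c := 2^-1 * (`|b| + 2^-1).
have b1 : `|b| < 2^-1 by rewrite ltr_norml; apply/andP; split; rewrite /b; lra.
have b0 := normr_ge0 b.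
have cb : `|b| < c by rewrite /c; lra.
have c1 : c < 2^-1 by rewrite /c; lra.
pose e0 := c - `|b|; have e00 : 0 < e0 by rewrite subr_gt0.
pose e_ n : R := e0 * n.+1%:R^-1.
have en n : 0 < e_ n <= e0.
  rewrite mulr_gt0 ?invr_gt0//= ler_piMr//; [exact: ltW|by rewrite invf_le1 ?ler1n].
have ce : e_ n @[n --> \oo] --> 0.
  by rewrite -[X in _ --> X](mulr0 e0); apply: cvgMr; exact: cvg_harmonic.
have bn n : `|H' - e_ n - 2^-1| <= c.
  have /andP[e1 e2] := en n.
  rewrite (_ : H' - e_ n - 2^-1 = b - e_ n); last by rewrite /b; ring.
  rewrite (le_trans (ler_normB _ _))// (gtr0_norm e1); rewrite /e0 in e2; lra.
have a1 : - 2^-1 < H - 2^-1 < 2^-1 by apply/andP; split; lra.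
have [||n|w fw vw] := @kernel_product_limit R (H - 2^-1) b c (fun n => H' - e_ n - 2^-1)
  (fun n => kernel_covariance (H - 2^-1) (H' - e_ n - 2^-1) t s) t s iQ a1 _ bn.
- by rewrite c1 andbT (le_lt_trans b0).
- by apply: cvgB; [rewrite -[X in _ --> X]subr0; apply: cvgB => //; exact: cvg_cst|exact: cvg_cst].
- apply: integral_kernel_product => //.
    by rewrite -ltr_norml (le_lt_trans (bn n)).
  have /andP[e1 _] := en n; rewrite lt_eqF//; lra.
suff <- : w = Gamma_product H H' * log_covariance H H' t s by [].
apply: (cvg_unique _ vw); first exact: Rhausdorff.
apply: kernel_covariance_limit => // n; have /andP[-> e2] := en n.
by rewrite (le_lt_trans e2)//= /e0; lra.
Qed.
End closed_forms.

(** * Isometries and square-integrable limits *)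
Section L2_limits.
Context {d : measure_display} {T : measurableType d} {R : realType}.
Variable mu : {measure set T -> \bar R}.
Implicit Types (f g : T -> R).

Lemma square_products_integrable f g : measurable_fun setT f -> measurable_fun setT g ->
  mu.-integrable setT (EFin \o (fun x => f x ^+ 2)) ->
  mu.-integrable setT (EFin \o (fun x => g x ^+ 2)) ->
  mu.-integrable setT (EFin \o (fun x => f x * g x)).
Proof.
move=> mf mg /integrable_has_integral[v fv] /integrable_has_integral[w gw].
apply: (dominated_integrable (has_integralD fv gw).1); first exact: measurable_funM.
move=> x; rewrite -subr_ge0 -[f x ^+ 2]real_normK ?num_real// -[g x ^+ 2]real_normK ?num_real//.
rewrite normrM; move: `|f x| `|g x| (normr_ge0 (f x)) (normr_ge0 (g x)) => a b a0 b0.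
have -> : a ^+ 2 + b ^+ 2 - a * b = (a - b) ^+ 2 + a * b by ring.
by rewrite addr_ge0 ?sqr_ge0 ?mulr_ge0.
Qed.

(** Only the tail of the sequence has to be square integrable after subtracting the
    limit; the numbers [e_ n] are then the squared distances. *)
Definition L2_cvg (f_ : nat -> T -> R) f := exists2 e_ : nat -> R, e_ n @[n --> \oo] --> 0 &
  \forall n \near \oo, has_integral mu (fun x => (f_ n x - f x) ^+ 2) (e_ n).

Lemma L2_cvgP (f_ : nat -> T -> R) f :
  (forall n, measurable_fun setT (f_ n)) -> measurable_fun setT f ->
  (\int[mu]_x ((f_ n x - f x) ^+ 2)%:E)%E @[n --> \oo] --> 0%E -> L2_cvg f_ f.
Proof.
move=> mf_ mf ff; exists (fun n => fine (\int[mu]_x ((f_ n x - f x) ^+ 2)%:E)%E).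
  exact: (fine_cvg ff).
have /fine_cvgP[fin _] := ff.
near=> n; apply: ge0_has_integral.
- by apply: measurable_funX; exact: measurable_funB.
- by move=> x; exact: sqr_ge0.
- by rewrite fineK//; near: n.
Unshelve. all: by end_near. Qed.

(** For every [eta > 0], [|A^2 - B^2| <= (1 + 1 / eta) * (A - B)^2 + eta * B^2].  With
    [eta] small the last term is small after integration, and then [n] is taken large. *)
Lemma square_limit (f_ : nat -> T -> R) f (q : nat -> R) :
  (forall n, measurable_fun setT (f_ n)) -> measurable_fun setT f ->
  (forall n, has_integral mu (fun x => f_ n x ^+ 2) (q n)) -> L2_cvg f_ f ->
  exists2 v, has_integral mu (fun x => f x ^+ 2) v & q n @[n --> \oo] --> v.
Proof.
move=> mf_ mf fq [e_ e0 fe].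
have [v fv] : exists v, has_integral mu (fun x => f x ^+ 2) v.
  have [N _ /(_ N (leqnn N)) HN] := fe.
  apply: integrable_has_integral.
  apply: (dominated_integrable
    (has_integralD (has_integralZ 2 (fq N)) (has_integralZ 2 HN)).1).
    exact: measurable_funX.
  move=> x; rewrite ger0_norm ?sqr_ge0// -subr_ge0.
  rewrite (_ : _ - _ = (2 * f_ N x - f x) ^+ 2) ?sqr_ge0//; ring.
have v0 : 0 <= v by apply: has_integral_ge0 fv => x; exact: sqr_ge0.
exists v => //.
apply/cvgrPdist_le => eps eps0.
(* [v + 1] rather than [v], which may be [0] *)
pose eta := eps / (2 * (v + 1)).
have v1 : 0 < v + 1 by lra.
have eta0 : 0 < eta by rewrite divr_gt0// mulr_gt0.
have bound n : has_integral mu (fun x => (f_ n x - f x) ^+ 2) (e_ n) ->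
    `|v - q n| <= (1 + eta^-1) * e_ n + eta * v.
  move=> en; have H := has_integralD (has_integralZ (1 + eta^-1) en) (has_integralZ eta fv).
  have eta_n0 : eta != 0 by rewrite gt_eqF.
  rewrite ler_norml lerNl; apply/andP; split.
    rewrite opprB; apply: (le_has_integral (has_integralB (fq n) fv) H) => x.
    rewrite -subr_ge0; move: (f_ n x) (f x) => A B.
    have -> : (1 + eta^-1) * (A - B) ^+ 2 + eta * B ^+ 2 - (A ^+ 2 - B ^+ 2) =
      eta^-1 * ((A - B) - eta * B) ^+ 2 by field.
    by rewrite mulr_ge0 ?sqr_ge0// invr_ge0 ltW.
  apply: (le_has_integral (has_integralB fv (fq n)) H) => x.
  rewrite -subr_ge0; move: (f_ n x) (f x) => A B.
  have -> : (1 + eta^-1) * (A - B) ^+ 2 + eta * B ^+ 2 - (B ^+ 2 - A ^+ 2) =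
    eta^-1 * ((A - B) + eta * B) ^+ 2 + 2 * (A - B) ^+ 2 by field.
  by rewrite addr_ge0// mulr_ge0 ?sqr_ge0// invr_ge0 ltW.
have vb : eta * v <= eps / 2.
  rewrite /eta -subr_ge0 (_ : _ - _ = eps / 2 / (v + 1)); last by field; rewrite gt_eqF.
  by rewrite !divr_ge0 ?ltW.
have k0 : 0 < 1 + eta^-1 by rewrite addr_gt0 ?invr_gt0.
near=> n.
rewrite (le_trans (bound n _))//; first by near: n.
have -> : eps = eps / 2 + eps / 2 by field.
rewrite lerD// mulrC -ler_pdivlMr//.
apply: ltW; near: n; apply: (cvgr_lt _ e0).
by rewrite !divr_gt0.
Unshelve. all: by end_near. Qed.

Lemma L2_cvgD (f_ g_ : nat -> T -> R) f g :
  (forall n, measurable_fun setT (f_ n)) -> (forall n, measurable_fun setT (g_ n)) ->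
  measurable_fun setT f -> measurable_fun setT g ->
  L2_cvg f_ f -> L2_cvg g_ g ->
  L2_cvg (fun n x => f_ n x + g_ n x) (fun x => f x + g x).
Proof.
move=> mf_ mg_ mf mg [a_ a0 fa] [b_ b0 gb].
pose D n x := f_ n x + g_ n x - (f x + g x).
have mD n : measurable_fun setT (D n).
  by apply: measurable_funB; exact: measurable_funD.
have DP n : has_integral mu (fun x => (f_ n x - f x) ^+ 2) (a_ n) ->
    has_integral mu (fun x => (g_ n x - g x) ^+ 2) (b_ n) ->
    exists2 c, has_integral mu (fun x => D n x ^+ 2) c & 0 <= c <= 2 * a_ n + 2 * b_ n.
  move=> fn gn; have H := has_integralD (has_integralZ 2 fn) (has_integralZ 2 gn).
  have le x : D n x ^+ 2 <= 2 * (f_ n x - f x) ^+ 2 + 2 * (g_ n x - g x) ^+ 2.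
    rewrite -subr_ge0 /D (_ : _ - _ = (f_ n x - f x - (g_ n x - g x)) ^+ 2) ?sqr_ge0//.
    by ring.
  have [|c Dc] := @integrable_has_integral _ _ _ mu (fun x => D n x ^+ 2).
    apply: (dominated_integrable H.1); first exact: measurable_funX.
    by move=> x; rewrite ger0_norm ?sqr_ge0.
  exists c => //; apply/andP; split; last exact: le_has_integral Dc H le.
  by apply: has_integral_ge0 Dc => x; exact: sqr_ge0.
pose c_ n := fine (\int[mu]_x (D n x ^+ 2)%:E)%E.
exists c_; last first.
  near=> n; have [||c Dc _] := DP n; [by near: n|by near: n|].
  by rewrite /c_ Dc.2.
have cv : 2 * a_ n + 2 * b_ n @[n --> \oo] --> 0.
  by rewrite -[X in _ --> X](addr0 0) -[X in _ --> X + X](mulr0 2); apply: cvgD; exact: cvgMr.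
apply: (squeeze_cvgr _ (cvg_cst 0) cv).
near=> n; have [||c Dc cb] := DP n; [by near: n|by near: n|].
by rewrite /c_ Dc.2.
Unshelve. all: by end_near. Qed.
End L2_limits.

Section isometry.
Context {d1 d2 : measure_display} {T1 : measurableType d1} {T2 : measurableType d2} {R : realType}.
Variables (m1 : {measure set T1 -> \bar R}) (m2 : {measure set T2 -> \bar R}).

Lemma square_isometry_limit (f_ : nat -> T1 -> R) (g_ : nat -> T2 -> R) f g :
  (forall n, measurable_fun setT (f_ n)) -> (forall n, measurable_fun setT (g_ n)) ->
  measurable_fun setT f -> measurable_fun setT g ->
  (forall n, exists2 q, has_integral m1 (fun x => f_ n x ^+ 2) q &
     has_integral m2 (fun x => g_ n x ^+ 2) q) ->
  L2_cvg m1 f_ f -> L2_cvg m2 g_ g ->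
  exists2 v, has_integral m1 (fun x => f x ^+ 2) v & has_integral m2 (fun x => g x ^+ 2) v.
Proof.
move=> mf_ mg_ mf mg /(_ _)/cid2 H ff gg.
pose q n := sval (H n).
have fq n : has_integral m1 (fun x => f_ n x ^+ 2) (q n) by rewrite /q; case: (H n).
have gq n : has_integral m2 (fun x => g_ n x ^+ 2) (q n) by rewrite /q; case: (H n).
have [v fv qv] := square_limit mf_ mf fq ff.
have [w gw qw] := square_limit mg_ mg gq gg.
by exists v => //; rewrite (cvg_unique _ qv qw).
Qed.

Lemma product_isometry (f g : T1 -> R) (h k : T2 -> R) a b c :
  has_integral m1 (fun x => f x ^+ 2) a -> has_integral m2 (fun x => h x ^+ 2) a ->
  has_integral m1 (fun x => g x ^+ 2) b -> has_integral m2 (fun x => k x ^+ 2) b ->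
  has_integral m1 (fun x => (f x + g x) ^+ 2) c ->
  has_integral m2 (fun x => (h x + k x) ^+ 2) c ->
  exists2 v, has_integral m1 (fun x => f x * g x) v & has_integral m2 (fun x => h x * k x) v.
Proof.
move=> fa ha gb kb fgc hkc; exists (2^-1 * (c - a - b)).
  apply: has_integralP (has_integralZ 2^-1 (has_integralB (has_integralB fgc fa) gb)) => // x.
  by field.
apply: has_integralP (has_integralZ 2^-1 (has_integralB (has_integralB hkc ha) kb)) => // x.
by field.
Qed.

End isometry.

Section step_sums.
Context {d : measure_display} {T : measurableType d} {R : realType}.
Variables (mu : {measure set T -> \bar R}) (X : R -> T -> R) (c : R -> R -> R).
Hypothesis structure : forall u v, has_integral mu (fun w => (X v w - X u w) ^+ 2) (c u v).

Definition step_sum (f : @step_data R) (w : T) : R :=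
  \sum_(p <- f) p.1 * (X p.2.2 w - X p.2.1 w).

Lemma measurable_step_sum f : (forall v, measurable_fun setT (X v)) ->
  measurable_fun setT (step_sum f).
Proof.
move=> mX; apply: measurable_sum => p.
by apply: measurable_funM => //; exact: measurable_funB.
Qed.

Definition step_norm (f : @step_data R) : R :=
  \sum_(p <- f) \sum_(r <- f) p.1 * r.1 *
    (2^-1 * (c r.2.1 p.2.2 + c p.2.1 r.2.2 - c r.2.2 p.2.2 - c p.2.1 r.2.1)).

(** [(X v - X u) * (X v' - X u')] is half of
    [(X v - X u')^2 + (X u - X v')^2 - (X v - X v')^2 - (X u - X u')^2], so that second
    moments of increments give those of all step sums. *)
Lemma has_integral_step_sum f : has_integral mu (fun w => step_sum f w ^+ 2) (step_norm f).
Proof.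
have H : has_integral mu (fun w => \sum_(p <- f) \sum_(r <- f)
    p.1 * r.1 * ((X p.2.2 w - X p.2.1 w) * (X r.2.2 w - X r.2.1 w))) (step_norm f).
  apply: has_integral_sum => p; apply: has_integral_sum => r; apply: has_integralZ.
  have := has_integralZ 2^-1 (has_integralB (has_integralB (has_integralD
    (structure r.2.1 p.2.2) (structure p.2.1 r.2.2)) (structure r.2.2 p.2.2))
    (structure p.2.1 r.2.1)).
  by apply: has_integralP => // w; field.
apply: has_integralP H => // w; rewrite /step_sum expr2 mulr_suml.
apply: eq_bigr => p _; rewrite mulr_sumr; apply: eq_bigr => r _; ring.
Qed.
End step_sums.

(** * Moments of the normal distribution *)
Section density.
Context {d : measure_display} {T : measurableType d} {R : realType}.
Notation leb := (@lebesgue_measure R).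
Variable P : probability T R.

Lemma layer_cake (z : R) : 0 <= z -> has_integral leb (fun y => \1_(`]0, z]) y) z.
Proof.
move=> z0; apply: has_integralP (integral_powR0 z0 (@ltr01 R)) => // [y|].
  by rewrite subrr powRr0 mulr1.
by rewrite divr1 powRr1.
Qed.

(** By the layer cake formula, both sides are integrals over [y > 0] of the
    probability of [y <= f X], which the density computes. *)
Lemma has_integral_density (X : T -> R) (g : R -> R) : measurable_fun setT X ->
  (forall x, 0 <= g x) -> leb.-integrable setT (EFin \o g) ->
  (forall A : set R, measurable A -> P (X @^-1` A) = (\int[leb]_(x in A) (g x)%:E)%E) ->
  forall (f : R -> R) v, measurable_fun setT f -> (forall x, 0 <= f x) ->
  has_integral leb (fun x => f x * g x) v -> has_integral P (fun w => f (X w)) v.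
Proof.
move=> mX g0 gi Xg f v mf f0 fgv.
have mg : measurable_fun setT g by apply/measurable_EFinP; exact: measurable_int gi.
pose A y : set R := [set x | y <= f x].
have mA y : measurable (A y) by rewrite -[A y]setTI; exact: measurable_fun_le.
have mXA y : measurable (X @^-1` A y).
  by rewrite -[X @^-1` _]setTI; exact: mX.
pose k y : R := if 0 < y then fine (P (X @^-1` A y)) else 0.
pose F (z : T * R) : R := if 0 < z.2 then (if z.2 <= f (X z.1) then 1 else 0) else 0.
have mF : measurable_fun setT F.
  apply: measurable_fun_ifT => //; first exact: measurable_fun_ltr.
  apply: measurable_fun_ifT => //; apply: measurable_fun_ler => //.
  by apply: (measurableT_comp mf); exact: (measurableT_comp mX).
have F0 z : 0 <= F z by rewrite /F; case: ifP => // _; case: ifP.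
have F1 w : has_integral leb (fun y => F (w, y)) (f (X w)).
  apply: has_integralP (layer_cake (f0 (X w))) => // y.
  by rewrite /F/= indic_itv_ocE; case: (0 < y); case: (y <= _).
have F2 y : has_integral P (fun w => F (w, y)) (k y).
  rewrite /F /k/=; case: ifP => y0; last exact: has_integral0.
  have := @has_integral_indic _ _ _ P (X @^-1` A y) (fun=> 1) (fine (P (X @^-1` A y))) (mXA y).
  have E : (\int[P]_(x in X @^-1` A y) 1%:E)%E = (fine (P (X @^-1` A y)))%:E.
    by rewrite integral_cst// mul1e fineK// fin_num_measure.
  move=> /(_ _ E) H; apply: has_integralP (H _) => // [w|].
    by rewrite mulr1 indicE; case: ifPn => yf; [rewrite mem_set|rewrite memNset//; exact: negP].
  exact: finite_measure_integrable_cst.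
pose F' (z : R * R) : R := (if 0 < z.1 then (if z.1 <= f z.2 then 1 else 0) else 0) * g z.2.
have mF' : measurable_fun setT F'.
  apply: measurable_funM; last exact: (measurableT_comp mg).
  apply: measurable_fun_ifT => //; first exact: measurable_fun_ltr.
  apply: measurable_fun_ifT => //; apply: measurable_fun_ler => //.
  exact: (measurableT_comp mf).
have F'0 z : 0 <= F' z by rewrite /F' mulr_ge0//; case: ifP => // _; case: ifP.
have F'1 y : has_integral leb (fun x => F' (y, x)) (k y).
  rewrite /F' /k/=; case: ifP => y0; last first.
    by apply: has_integralP (has_integral0 _) => // x; rewrite mul0r.
  have E : (\int[leb]_(x in A y) (g x)%:E)%E = (fine (P (X @^-1` A y)))%:E.
    by rewrite -Xg// fineK// fin_num_measure.
  have iA : leb.-integrable (A y) (EFin \o g).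
    exact: (@integrableS _ _ _ leb setT (A y) _ measurableT (mA y) _ gi).
  apply: has_integralP (@has_integral_indic _ _ _ leb (A y) g _ (mA y) iA E) => // x.
  by rewrite indicE; case: ifPn => yf; [rewrite mem_set|rewrite memNset//; exact: negP].
have F'2 x : has_integral leb (fun y => F' (y, x)) (f x * g x).
  apply: has_integralP (has_integralZ (g x) (layer_cake (f0 x))) => // [y|]; last exact: mulrC.
  by rewrite /F'/= indic_itv_ocE; case: (0 < y); case: (y <= _) => /=; ring.
have kv := @tonelli _ _ _ _ _ leb leb F' k _ _ mF' F'0 F'1 F'2 fgv.
exact: (@tonelli _ _ _ _ _ P leb F _ k _ mF F0 F1 F2 kv).
Qed.
End density.

Section gaussian_moments.
Context {R : realType}.
Notation leb := (@lebesgue_measure R).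
Variable sigma : R.
Hypothesis sigma0 : sigma != 0.

Let G (x : R) : R := expR (- (x ^+ 2) / (2 * sigma ^+ 2)).

Let s2 : 0 < sigma ^+ 2. Proof. by rewrite exprn_even_gt0. Qed.

#[local] Instance dG (x : R) : is_derive x (1 : R) G (- (x / sigma ^+ 2) * G x).
Proof.
by apply: is_derive_eq; rewrite /GRing.scale /= /G; field.
Qed.

Let mG : measurable_fun setT G.
Proof.
by apply: continuous_measurable_fun => x; exact: is_derive_continuous.
Qed.

Let GN x : G (- x) = G x. Proof. by rewrite /G sqrrN. Qed.

Let normal_pdf_G x : normal_pdf 0 sigma x = normal_peak sigma * G x.
Proof.
by rewrite normal_pdfE// /normal_pdf /normal_fun /G subr0 -mulr_natl.
Qed.

Let G_cvg : G x @[x --> +oo] --> 0.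
Proof.
pose k := (Num.sqrt (2 * sigma ^+ 2))^-1.
have k0 : 0 < k by rewrite invr_gt0 sqrtr_gt0 mulr_gt0.
have -> : G = gauss_fun \o (fun x => x * k).
  apply/funext => x; rewrite /G /gauss_fun /= exprMn /k exprVn sqr_sqrtr ?mulNr//.
  by rewrite mulr_ge0// ltW.
apply: (cvg_comp (fun x => x * k) (@gauss_fun R) _ (@cvg_gauss_fun R)).
by apply: gt0_cvgMly => //; exact: cvg_id.
Qed.

Let G_tail x : 0 <= x -> has_integral leb
  (fun v => \1_([set` Interval (BSide true x) +oo%O]) v * (v / sigma ^+ 2 * G v)) (G x).
Proof.
move=> x0.
have := @has_integral_FTC2y R (fun v => - G v) (fun v => v / sigma ^+ 2 * G v) true x 0.
rewrite sub0r opprK; apply.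
- by move=> v xv; rewrite mulr_ge0 ?expR_ge0// divr_ge0 ?(ltW s2)// (le_trans x0).
- by move=> v; apply: is_derive_eq; rewrite mulNr opprK.
- by move=> v; exact: is_derive_continuous.
- by rewrite -oppr0; exact: cvgN.
Qed.

Lemma normal_pdf_integral : has_integral leb (normal_pdf 0 sigma) 1.
Proof. by split; [exact: integrable_normal_pdf|exact: integral_normal_pdf]. Qed.

(** [G] is the tail integral of [v / sigma^2 * G v].  Exchanging the integrals over
    [0 < x <= v] replaces the inner integration over [x] by a factor [v]. *)
Let G_half m : has_integral leb (fun x => pospow x 0 * G x) m ->
  has_integral leb (fun x => pospow x 0 * (x ^+ 2 / sigma ^+ 2 * G x)) m.
Proof.
move=> Gm.
pose F (z : R * R) := pospow z.2 0 * (if z.2 <= z.1 then 1 else 0) * (z.1 / sigma ^+ 2 * G z.1).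
have mF : measurable_fun setT F.
  apply: measurable_funM.
    apply: measurable_funM; first exact: measurable_pospow_comp.
    by apply: measurable_fun_ifT => //; exact: measurable_fun_ler.
  apply: measurable_funM; first exact: measurable_funM.
  exact: (measurableT_comp mG).
have F0 z : 0 <= F z.
  rewrite /F /pospow powRr0; case: ifPn => z0; last by rewrite !mul0r.
  case: ifPn => zz; last by rewrite mulr0 mul0r.
  by rewrite !mul1r mulr_ge0 ?expR_ge0// divr_ge0 ?(ltW s2)// (le_trans (ltW z0)).
have F1 v : has_integral leb (fun x => F (v, x)) (pospow v 0 * (v ^+ 2 / sigma ^+ 2 * G v)).
  have [v0|v0] := ltP 0 v; last first.
    rewrite pospow_le0E// mul0r; apply: has_integralP (has_integral0 _) => // x.
    rewrite /F/=; case: ifPn => xv; last by rewrite mulr0 mul0r.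
    by rewrite pospow_le0E ?mul0r// (le_trans xv).
  apply: has_integralP (has_integralZ (v / sigma ^+ 2 * G v) (layer_cake (ltW v0))) => [x|].
    by rewrite /F/= indic_itv_ocE /pospow powRr0; case: (0 < x); case: (x <= v) => /=; ring.
  by rewrite pospow_gt0E// powRr0; ring.
have F2 x : has_integral leb (fun v => F (v, x)) (pospow x 0 * G x).
  have [x0|x0] := ltP 0 x; last first.
    rewrite pospow_le0E// mul0r; apply: has_integralP (has_integral0 _) => // v.
    by rewrite /F/= pospow_le0E// !mul0r.
  apply: has_integralP (G_tail (ltW x0)) => [v|]; last by rewrite pospow_gt0E// powRr0 mul1r.
  rewrite /F/= indicE mem_setE in_itv/= andbT pospow_gt0E// powRr0 mul1r.
  by case: ifP.
exact: (@tonelli _ _ _ _ _ leb leb F _ _ _ mF F0 F1 F2 Gm).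
Qed.

Let even_has_integral (f : R -> R) m : measurable_fun setT f -> (forall x, f (- x) = f x) ->
  has_integral leb (fun x => pospow x 0 * f x) m -> has_integral leb f (m + m).
Proof.
move=> mf fN fm.
have := has_integralD (has_integralD fm (has_integral_reflect 0 fm)) (has_integral_set1 0 mf).
apply: has_integralP => [x|]; last by rewrite addr0.
rewrite sub0r fN indicE classical_sets.in_set1 /pospow powRr0 powRr0 oppr_gt0.
by case: ltgtP => _ /=; ring.
Qed.

Lemma normal_pdf_second_moment :
  has_integral leb (fun x => x ^+ 2 * normal_pdf 0 sigma x) (sigma ^+ 2).
Proof.
have peak0 : normal_peak sigma != 0 by rewrite gt_eqF// normal_peak_gt0.
have G1 : has_integral leb G (normal_peak sigma)^-1.
  apply: has_integralP (has_integralZ (normal_peak sigma)^-1 normal_pdf_integral) => [x|].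
    by rewrite normal_pdf_G mulKf.
  by rewrite mulr1.
have [|m Gm] := @integrable_has_integral _ _ _ leb (fun x => pospow x 0 * G x).
  apply: (dominated_integrable G1.1).
    by apply: measurable_funM => //; exact: measurable_pospow.
  move=> x; rewrite ger0_norm ?mulr_ge0 ?pospow_ge0 ?expR_ge0//.
  rewrite ler_piMl ?expR_ge0// /pospow powRr0; by case: ifP.
have mm : m + m = (normal_peak sigma)^-1.
  apply: has_integral_unique G1; exact: even_has_integral Gm.
have mf : measurable_fun setT (fun x : R => x ^+ 2 / sigma ^+ 2 * G x).
  by apply: measurable_funM => //; apply: measurable_funM => //; exact: measurable_funX.
have fN (x : R) : (- x) ^+ 2 / sigma ^+ 2 * G (- x) = x ^+ 2 / sigma ^+ 2 * G x.
  by rewrite sqrrN GN.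
have := even_has_integral mf fN (G_half Gm); rewrite mm.
move=> /(has_integralZ (normal_peak sigma * sigma ^+ 2)).
apply: has_integralP => [x|]; last by rewrite mulrAC divff// mul1r.
by rewrite normal_pdf_G; field.
Qed.

(** The mean is [0] because the two halves have the same integral; they are kept
    apart since [has_integral_density] is about nonnegative functions. *)
Lemma normal_pdf_first_moment : exists2 m,
  has_integral leb (fun x => Num.max x 0 * normal_pdf 0 sigma x) m &
  has_integral leb (fun x => Num.max (- x) 0 * normal_pdf 0 sigma x) m.
Proof.
have H := has_integralD normal_pdf_integral normal_pdf_second_moment.
have [|m Hm] := @integrable_has_integral _ _ _ leb (fun x => Num.max x 0 * normal_pdf 0 sigma x).
  apply: (dominated_integrable H.1).
    apply: measurable_funM; last exact: measurable_normal_pdf.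
    exact: measurable_maxr.
  move=> x; rewrite ger0_norm ?mulr_ge0 ?normal_pdf_ge0 ?le_max ?lexx ?orbT//.
  rewrite -[X in X + _]mul1r -mulrDl ler_wpM2r ?normal_pdf_ge0//.
  rewrite ge_max; apply/andP; split; last by rewrite addr_ge0 ?sqr_ge0.
  by rewrite -subr_ge0 (_ : _ - _ = (x - 2^-1) ^+ 2 + 3 / 4) ?addr_ge0 ?sqr_ge0//; field.
exists m => //; apply: has_integralP (has_integral_reflect 0 Hm) => // x.
by rewrite sub0r !normal_pdf_G GN.
Qed.

End gaussian_moments.

(** * Second moments of Brownian increments *)
Lemma ae_has_integral d (T : measurableType d) (R : realType)
    (mu : {measure set T -> \bar R}) (f g : T -> R) v :
  measurable_fun setT g -> {ae mu, forall x, f x = g x} ->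
  has_integral mu f v -> has_integral mu g v.
Proof.
move=> mg fg fv; have mf := has_integral_measurable fv.
have E (h : R -> \bar R) : measurable_fun setT h ->
    (\int[mu]_x h (f x) = \int[mu]_x h (g x))%E.
  move=> mh; apply: ae_eq_integral => //.
  - exact: (measurableT_comp mh mf).
  - exact: (measurableT_comp mh mg).
  by move: fg; apply: filterS => x fgx _; rewrite fgx.
split; last by rewrite -(E (@EFin R))// fv.2.
have /integrableP[_ fi] := fv.1.
apply/integrableP; split; first exact/measurable_EFinP.
rewrite -(E (fun r => `|r%:E|%E))//.
exact: measurableT_comp.
Qed.

Section independence.
Context {d : measure_display} {T : measurableType d} {R : realType}.
Variable P : probability T R.

Lemma has_integral_distribution (X : {RV P >-> R}) (f : R -> R) v : measurable_fun setT f ->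
  has_integral P (fun w => f (X w)) v -> has_integral (distribution P X) f v.
Proof.
move=> mf [fi fv].
have mX : measurable_fun setT (X : T -> R) by [].
split.
  apply: (@integrable_pushforward _ _ _ _ _ X mX P setT (EFin \o f)) => //.
  exact/measurable_EFinP.
rewrite -fv.
rewrite (@integral_pushforward _ _ _ _ _ X mX P setT (EFin \o f))//.
exact/measurable_EFinP.
Qed.

(** The joint law is the product of the two laws, since they agree on rectangles, and
    the inner integral of [x * y] over [y] vanishes. *)
Lemma independent_product (X Y : {RV P >-> R}) a b :
  (forall A B : set R, measurable A -> measurable B ->
    P ((X @^-1` A) `&` (Y @^-1` B)) = (P (X @^-1` A) * P (Y @^-1` B))%E) ->
  has_integral P (fun w => X w ^+ 2) a -> has_integral P (fun w => Y w ^+ 2) b ->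
  has_integral P Y 0 -> has_integral P (fun w => X w * Y w) 0.
Proof.
move=> XY Xa Yb Y0.
have mX : measurable_fun setT (X : T -> R) by [].
have mY : measurable_fun setT (Y : T -> R) by [].
have iXY := square_products_integrable mX mY Xa.1 Yb.1.
pose phi w := (X w, Y w).
have mphi : measurable_fun setT phi by exact: measurable_fun_pair.
pose m1 := distribution P X; pose m2 := distribution P Y.
pose f (z : R * R) := (z.1 * z.2)%:E.
have mf : measurable_fun setT f by apply/measurable_EFinP; exact: measurable_funM.
pose m' := image_measure P mphi.
have mE (C : set (R * R)) : measurable C -> (m1 \x m2)%E C = m' C.
  by apply: product_measure_unique => A B mA mB; rewrite /m' /= /pushforward -XY.
have abs_fin (Z : {RV P >-> R}) c : has_integral P (fun w => Z w ^+ 2) c ->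
    exists e, has_integral (distribution P Z) (fun x => `|x|) e.
  move=> Zc; have [|e Ze] := @integrable_has_integral _ _ _ P (fun w => `|Z w|).
    have one : has_integral P (fun=> 1) 1.
      by apply: ge0_has_integral => //; rewrite integral_cst//= mul1e; exact: probability_setT.
    apply: (dominated_integrable (has_integralD one Zc).1).
      by apply: (measurableT_comp (@normr_measurable R setT)).
    move=> w; rewrite normr_id -[Z w ^+ 2]real_normK ?num_real//.
    rewrite -subr_ge0 (_ : _ - _ = (`|Z w| - 2^-1) ^+ 2 + 3 / 4) ?addr_ge0 ?sqr_ge0//.
    by field.
  by exists e; apply: has_integral_distribution Ze; exact: normr_measurable.
have [c Xc] := abs_fin X a Xa; have [e Ye] := abs_fin Y b Yb.
have fi : (m1 \x m2)%E.-integrable setT f.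
  apply/integrable12ltyP => //.
  have E x : (\int[m2]_y `|f (x, y)| = (e * `|x|)%:E)%E.
    rewrite mulrC -(has_integralZ `|x| Ye).2.
    by apply: eq_integral => y _; rewrite /f /= normrM.
  under eq_integral do rewrite E.
  by rewrite (has_integralZ e Xc).2 ltry.
have Y0' : has_integral m2 idfun 0.
  exact: (@has_integral_distribution Y idfun 0 (@measurable_id _ _ setT) Y0).
have [v XYv] := integrable_has_integral iXY.
suff <- : v = 0 by [].
apply/EFin_inj; rewrite -XYv.2.
transitivity (\int[m']_z f z)%E.
  by rewrite (@integral_pushforward _ _ _ _ _ phi mphi P setT f).
transitivity (\int[(m1 \x m2)%E]_z f z)%E.
  by apply: eq_measure_integral => C mC _; apply: esym; exact: mE.
rewrite -(integral12_prod_meas1 fi) integral0_eq// => x _.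
by rewrite /fubini_F /f /= (has_integralZ x Y0').2 mulr0.
Qed.
End independence.

Section brownian.
Context {d : measure_display} {T : measurableType d} {R : realType}.
Variable P : probability T R.

Section half_line.
Variable W : R -> {RV P >-> R}.
Hypothesis hW : standard_brownian_motion W.

Lemma brownian_increment (s t : R) : 0 <= s -> s < t ->
  has_integral P (fun w => (W t w - W s w) ^+ 2) (t - s) /\
  has_integral P (fun w => W t w - W s w) 0.
Proof.
move=> s0 st; have [_ _ /(_ s t s0 st) law _] := hW.
have sigma0 : Num.sqrt (t - s) != 0 by rewrite gt_eqF// sqrtr_gt0 subr_gt0.
have mX : measurable_fun setT ((W t : T -> R) \- W s).
  exact: measurable_funB.
have H := has_integral_density mX (@normal_pdf_ge0 R 0 (Num.sqrt (t - s)))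
  (normal_pdf_integral (Num.sqrt (t - s))).1 law.
split.
  have := normal_pdf_second_moment sigma0.
  rewrite sqr_sqrtr; last by rewrite subr_ge0 ltW.
  apply: H; [exact: measurable_funX|by move=> x; exact: sqr_ge0].
have [m m1 m2] := normal_pdf_first_moment sigma0.
have p := H _ _ _ _ m1; have n := H _ _ _ _ m2.
have mp : measurable_fun setT (fun x : R => Num.max x 0) by exact: measurable_maxr.
have mn : measurable_fun setT (fun x : R => Num.max (- x) 0) by exact: measurable_maxr.
have p0 (x : R) : 0 <= Num.max x 0 by rewrite le_max lexx orbT.
have := has_integralB (H _ _ mp p0 m1) (H _ _ mn (fun x => p0 (- x)) m2).
apply: has_integralP => [w|]; last by rewrite subrr.
rewrite /=; move: (W t w - W s w) => z; rewrite !maxElt oppr_lt0.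
by case: ltgtP => z0; lra.
Qed.

Lemma brownian_marginal (t : R) : 0 <= t ->
  has_integral P (fun w => W t w ^+ 2) t /\ has_integral P (W t) 0.
Proof.
have [W0 _ _ _] := hW.
rewrite le_eqVlt => /predU1P[<-|t0].
  split.
    apply: ae_has_integral (has_integral0 _); first exact: measurable_funX.
    by apply: filterS W0 => w ->; rewrite expr0n.
  by apply: ae_has_integral (has_integral0 _) => //; apply: filterS W0 => w ->.
have [Wt2 Wt1] := brownian_increment (lexx 0) t0.
rewrite subr0 in Wt2; split.
  apply: ae_has_integral Wt2; first exact: measurable_funX.
  by apply: filterS W0 => w ->; rewrite subr0.
by apply: ae_has_integral Wt1 => //; apply: filterS W0 => w ->; rewrite subr0.
Qed.
End half_line.

(** When [u < 0 <= v] the increment is [B2 v - B1 (- u)], the difference of two independent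
    centred variables with variances [v] and [- u]. *)
Lemma line_brownian_structure (B : R -> {RV P >-> R}) (u v : R) :
  brownian_motion_on_line B ->
  has_integral P (fun w => (B v w - B u w) ^+ 2) `|v - u|.
Proof.
move=> [B1 [B2 [hB1 hB2 indep BE]]].
wlog uv : u v / u <= v.
  move=> H; have [/H//|vu] := leP u v.
  rewrite distrC; apply: has_integralP (H v u (ltW vu)) => // w.
  by rewrite -sqrrN opprB.
rewrite ger0_norm ?subr_ge0//.
move: uv; rewrite le_eqVlt => /predU1P[->|uv].
  rewrite subrr; apply: has_integralP (has_integral0 _) => // w.
  by rewrite subrr expr0n.
have [v0|v0] := ltP v 0.
  have u0 := lt_trans uv v0.
  have Nv : 0 <= - v by rewrite oppr_ge0 ltW.
  have uv' : - v < - u by rewrite ltrN2.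
  apply: has_integralP (brownian_increment hB1 Nv uv').1 => [w|].
    by rewrite !BE v0 u0 -sqrrN opprB.
  by rewrite opprK addrC.
have [u0|u0] := ltP u 0; last first.
  apply: has_integralP (brownian_increment hB2 u0 uv).1 => // w.
  by rewrite !BE !ltNge v0 u0.
have Nu : 0 <= - u by rewrite oppr_ge0 ltW.
have [X2 X1] := brownian_marginal hB1 Nu.
have [Y2 Y1] := brownian_marginal hB2 v0.
have XY : has_integral P (fun w => B1 (- u) w * B2 v w) 0.
  apply: independent_product X2 Y2 Y1 => A C mA mC.
  apply: indep; apply: sub_sigma_algebra.
    by exists (- u); [rewrite /= in_itv/= Nu|exists A => //; rewrite setTI].
  by exists v; [rewrite /= in_itv/= v0|exists C => //; rewrite setTI].
apply: has_integralP (has_integralD (has_integralD Y2 X2) (has_integralZ (- 2) XY)) => [w|].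
  by rewrite !BE u0 ltNge v0 /=; ring.
by rewrite mulr0 addr0.
Qed.
End brownian.

(** * The Wiener isometry *)
Section wiener_isometry.
Context {d : measure_display} {T : measurableType d} {R : realType}.
Notation leb := (@lebesgue_measure R).
Variables (P : probability T R) (B : R -> {RV P >-> R}).
Hypothesis hB : brownian_motion_on_line B.
Implicit Types (f g : R -> R) (I J : {RV P >-> R}) (phi psi : @step_data R).

(** These play on the line the role of the variables [B v]: increments are the
    indicators of the intervals [(u, v]]. *)
Definition half_line_indic (v x : R) : R := if x <= v then 1 else 0.

Lemma half_line_structure u v :
  has_integral leb (fun x => (half_line_indic v x - half_line_indic u x) ^+ 2) `|v - u|.
Proof.
wlog uv : u v / u <= v.
  move=> H; have [/H//|vu] := leP u v.
  rewrite distrC; apply: has_integralP (H v u (ltW vu)) => // x.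
  by rewrite -sqrrN opprB.
rewrite ger0_norm ?subr_ge0//.
have uv0 : 0 <= v - u by rewrite subr_ge0.
apply: has_integralP (has_integral_shift (- u) (layer_cake uv0)) => // x.
rewrite indic_itv_ocE subr_gt0 lerD2r /half_line_indic.
have [xu|ux] := leP x u; first by rewrite (le_trans xu uv) subrr expr0n.
by rewrite subr0 /=; case: ifP; rewrite ?expr1n ?expr0n.
Qed.

Lemma step_funE phi : wf_step phi ->
  step_fun phi = step_sum half_line_indic phi.
Proof.
move=> /allP wf; apply/funext => x; rewrite /step_fun /step_sum.
apply: eq_big_seq => p /wf; move: p.2.1 p.2.2 => u v uv.
rewrite indic_itv_ocE /half_line_indic; congr (_ * _).
have [xu|ux] := leP x u; first by rewrite (le_trans xu uv) subrr.
by rewrite subr0 /=; case: ifP.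
Qed.

Lemma measurable_half_line_indic v : measurable_fun setT (half_line_indic v).
Proof. by apply: measurable_fun_ifT => //; exact: measurable_fun_ler. Qed.

Let measurable_step_sum_B phi : measurable_fun setT (step_sum (B : R -> T -> R) phi).
Proof. by apply: measurable_step_sum. Qed.

Let measurable_step_sum_half phi : measurable_fun setT (step_sum half_line_indic phi).
Proof. by apply: measurable_step_sum; exact: measurable_half_line_indic. Qed.

Lemma step_isometry phi : exists2 q,
  has_integral P (fun w => step_sum (B : R -> T -> R) phi w ^+ 2) q &
  has_integral leb (fun x => step_sum half_line_indic phi x ^+ 2) q.
Proof.
exists (step_norm (fun u v => `|v - u|) phi).
  by apply: has_integral_step_sum => u v; exact: line_brownian_structure.
by apply: has_integral_step_sum => u v; exact: half_line_structure.
Qed.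

Lemma wiener_approximation f I : is_wiener_integral B f I -> exists phi_ : nat -> step_data,
  L2_cvg leb (fun n => step_sum half_line_indic (phi_ n)) f /\
  L2_cvg P (fun n => step_sum (B : R -> T -> R) (phi_ n)) I.
Proof.
move=> [mf [phi_ [wf phif phiI]]]; exists phi_; split; apply: L2_cvgP => //.
- by move=> n; exact: measurable_step_sum_half.
- by under eq_cvg do under eq_integral do rewrite -step_funE//.
- by rewrite unlock in phiI.
Qed.

(** The sum of the two integrals is approximated by the concatenated step data,
    hence the isometry holds for it too, and polarization yields the product. *)
Lemma wiener_isometry f g I J : is_wiener_integral B f I -> is_wiener_integral B g J ->
  exists2 v, has_integral P (fun w => I w * J w) v & has_integral leb (fun x => f x * g x) v.
Proof.
move=> fI gJ; have [phi_ [phif phiI]] := wiener_approximation fI.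
have [psi_ [psig psiJ]] := wiener_approximation gJ.
have mf := fI.1; have mg := gJ.1.
have mB (f_ : nat -> @step_data R) n := measurable_step_sum_B (f_ n).
have mH (f_ : nat -> @step_data R) n := measurable_step_sum_half (f_ n).
have [a Ia fa] := @square_isometry_limit _ _ _ _ _ P leb _ _ _ _
  (mB phi_) (mH phi_) (measurable_funP I) mf (fun n => step_isometry (phi_ n)) phiI phif.
have [b Jb gb] := @square_isometry_limit _ _ _ _ _ P leb _ _ _ _
  (mB psi_) (mH psi_) (measurable_funP J) mg (fun n => step_isometry (psi_ n)) psiJ psig.
have sumE d' (S : measurableType d') (X : R -> S -> R) n x :
    step_sum X (phi_ n) x + step_sum X (psi_ n) x = step_sum X (phi_ n ++ psi_ n) x.
    by rewrite /step_sum big_cat.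
have IJ := L2_cvgD (mB phi_) (mB psi_) (measurable_funP I) (measurable_funP J) phiI psiJ.
have fg := @L2_cvgD _ _ _ leb _ _ _ _ (mH phi_) (mH psi_) mf mg phif psig.
have [||||n|c IJc fgc] := @square_isometry_limit _ _ _ _ _ P leb _ _ _ _ _ _ _ _ _ IJ fg.
- by move=> n; exact: measurable_funD.
- by move=> n; exact: (measurable_funD (mH phi_ n) (mH psi_ n)).
- exact: measurable_funD.
- exact: (measurable_funD mf mg).
- have [q Bq Hq] := step_isometry (phi_ n ++ psi_ n).
  by exists q; [apply: has_integralP Bq => // w|apply: has_integralP Hq => // x]; rewrite sumE.
exact: product_isometry Ia fa Jb gb IJc fgc.
Qed.

End wiener_isometry.

(** * The covariance *)
(** [Gamma_product] is what remains of the kernel integral once [Gamma (- h)] and the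
    trigonometric part are removed. *)
Lemma c_one_c_two (R : realType) (H H' : R) : 0 < H -> 0 < H' ->
  (c_one H)^-1 * (c_one H')^-1 * Gamma_product H H' = c_two H H'.
Proof.
move=> H0 H'0; rewrite /c_one /c_two /Gamma_product.
have G0 (h : R) : 0 < h -> Gamma (h + 2^-1) = Euler_Gamma (h + 2^-1) /\ Euler_Gamma (h + 2^-1) != 0.
  move=> h0; have h20 : 0 < h + 2^-1 by rewrite addr_gt0.
  by rewrite Gamma_gt0E// gt_eqF// Euler_Gamma_gt0.
have [-> G1] := G0 H H0; have [-> G2] := G0 H' H'0; rewrite !invf_div.
move: (Euler_Gamma _) (Euler_Gamma _) (Num.sqrt _) (Num.sqrt _) G1 G2 => g1 g2 s1 s2 G1 G2.
by move: (pi^-1 : R) => p; field; rewrite G1 G2.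
Qed.

Theorem theorem2 (d : measure_display) (T : measurableType d) (R : realType)
    (P : probability T R) (B : R -> {RV P >-> R})
    (hB : brownian_motion_on_line B)
    (BH : R -> R -> {RV P >-> R})
    (hBH : forall H : R, 0 < H < 1 -> is_moving_average B H (BH H))
    (H H' : R) (hH : 0 < H < 1) (hH' : 0 < H' < 1) (s t : R) :
  let K := ('E_P[(BH H t : T -> R) \* (BH H' s : T -> R)])%E in
  [/\ H + H' != 1 ->
        K = (c_two H H' * Gamma (- (H + H')) *
              (cos ((H' - H) * (pi / 2)) * cos ((H + H') * (pi / 2)) *
                 (`|t - s| `^ (H + H') - `|t| `^ (H + H') - `|s| `^ (H + H'))
               - sin ((H' - H) * (pi / 2)) * sin ((H + H') * (pi / 2)) *
                 (Num.sg t * `|t| `^ (H + H') - Num.sg s * `|s| `^ (H + H')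
                  - Num.sg (t - s) * `|t - s| `^ (H + H'))))%:E,
      H + H' = 1 -> t != s -> t != 0 -> s != 0 ->
        K = (c_two H H' *
              (cos ((H' - H) * (pi / 2)) * (pi / 2) * (`|t| + `|s| - `|t - s|)
               - sin ((H' - H) * (pi / 2)) *
                 (t * ln `|t| - s * ln `|s| - (t - s) * ln `|t - s|)))%:E,
      H + H' = 1 -> t = s -> t != 0 ->
        K = (c_two H H' * cos ((H' - H) * (pi / 2)) * (pi / 2)
             * (`|t| + `|s|))%:E
    & H + H' = 1 -> t = 0 \/ s = 0 -> K = 0%E].
Proof.
move=> K; have /andP[H0 H1] := hH; have /andP[H'0 H'1] := hH'.
have [I [fI XI]] := hBH H hH t; have [J [gJ XJ]] := hBH H' hH' s.
have [v IJv fgv] := wiener_isometry hB fI gJ.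
have iQ : kernel_products_integrable R.
  move=> a b x y a1 b1; have /andP[aN a2] := a1; have /andP[bN b2] := b1.
  have aH : 0 < a + 2^-1 < 1 by apply/andP; split; lra.
  have bH : 0 < b + 2^-1 < 1 by apply/andP; split; lra.
  have [I1 [+ _]] := hBH _ aH x; have [I2 [+ _]] := hBH _ bH y.
  rewrite !addrK => w2 w1; have [w _ fgw] := wiener_isometry hB w1 w2.
  exact: fgw.1.
have KE : K = ((c_one H)^-1 * (c_one H')^-1 * v)%:E.
  rewrite /K unlock -(has_integralZ ((c_one H)^-1 * (c_one H')^-1) IJv).2.
  by apply: eq_integral => w _; rewrite /= XI XJ mulrACA.
have cc := c_one_c_two H0 H'0.
have K1 : H + H' = 1 -> K = (c_two H H' * log_covariance H H' t s)%:E.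
  move=> HH; rewrite KE -cc.
  by rewrite (has_integral_unique fgv (integral_kernel_product1 t s iQ hH hH' HH)) mulrA.
split.
- move=> hne1; rewrite KE -cc.
  have ab : H - 2^-1 + (H' - 2^-1) != 0.
    by apply: contra_neq hne1 => E; lra.
  have a1 : - 2^-1 < H - 2^-1 < 2^-1 by apply/andP; split; lra.
  have b1 : - 2^-1 < H' - 2^-1 < 2^-1 by apply/andP; split; lra.
  have := has_integral_unique fgv (integral_kernel_product t s iQ a1 b1 ab).
  by rewrite kernel_covariance_trig ?addr_gt0// => ->; rewrite !mulrA.
- by move=> HH _ _ _; rewrite K1.
- move=> HH ts _; rewrite K1// /log_covariance -ts !subrr normr0 mul0r !subr0 mulr0 subr0.
  by rewrite !mulrA.
- move=> HH ts; rewrite K1// /log_covariance -[RHS]/(0 : R)%:E; congr EFin.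
  by case: ts => ->; rewrite ?sub0r ?subr0 ?normrN normr0; ring.
Qed.
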